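(* Let $(E_{-1},E_0,\partial,\rho,S,\diamond,\Omega)$ be an exact CLWX 2-algebroid over a manifold $M$. Let $F_{-1}=E_{-1}/\rho^*(T^*M)$ with projection $\mathrm{pr}:E_{-1}\to F_{-1}$ and, for $m\in\Gamma(F_{-1})$, let $\widetilde m\in\Gamma(E_{-1})$ denote any section with $\mathrm{pr}(\widetilde m)=m$. Define on $F_{-1}\oplus E_0$ $$l_1(m)=\partial(\widetilde m),\quad l_2(e^0_1,e^0_2)=e^0_1\diamond e^0_2,\quad l_2(e^0,m)=\mathrm{pr}(e^0\diamond\widetilde m),\quad l_2(m,e^0)=\mathrm{pr}(\widetilde m\diamond e^0),$$ $$l_3(e^0_1,e^0_2,e^0_3)=\mathrm{pr}\,\Omega(e^0_1,e^0_2,e^0_3).$$ Then $(F_{-1}\oplus E_0;\rho,l_1,l_2,l_3)$ is a quadratic Lie 2-algebroid (called the ample Lie 2-algebroid). Consequently, the exact CLWX 2-algebroid is an extension (called a CLWX-extension) of the quadratic Lie 2-algebroid $(F_{-1}\oplus E_0;\rho,l_1,l_2,l_3)$ by $T^*[1]M$ ($T^*M$ placed in degree $-1$), i.e. the following diagram commutes and has exact rows: $$\begin{array}{ccccccccc}0&\to&T^*[1]M&\xrightarrow{\rho^*}&E_{-1}&\xrightarrow{\mathrm{pr}}&F_{-1}&\to&0\\&&\downarrow{\scriptstyle0}&&\downarrow{\scriptstyle\partial}&&\downarrow{\scriptstyle l_1}&&\\0&\to&0&\to&E_0&\xrightarrow{=}&E_0&\to&0.\end{array}$$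
   Context: A Leibniz 2-algebra consists of a linear map $\mathrm d:V_{-1}\to V_0$, bilinear maps $l_2:V_{-i}\times V_{-j}\to V_{-i-j}$ ($0\le i+j\le1$) and a trilinear $l_3:V_0^3\to V_{-1}$ such that for $w,x,y,z\in V_0$, $m,n\in V_{-1}$: (a) $\mathrm dl_2(x,m)=l_2(x,\mathrm dm)$; (b) $\mathrm dl_2(m,x)=l_2(\mathrm dm,x)$; (c) $l_2(\mathrm dm,n)=l_2(m,\mathrm dn)$; (d) $\mathrm dl_3(x,y,z)=l_2(x,l_2(y,z))-l_2(l_2(x,y),z)-l_2(y,l_2(x,z))$; (e1) $l_3(x,y,\mathrm dm)=l_2(x,l_2(y,m))-l_2(l_2(x,y),m)-l_2(y,l_2(x,m))$; (e2) $l_3(x,\mathrm dm,y)=l_2(x,l_2(m,y))-l_2(l_2(x,m),y)-l_2(m,l_2(x,y))$; (e3) $l_3(\mathrm dm,x,y)=l_2(m,l_2(x,y))-l_2(l_2(m,x),y)-l_2(x,l_2(m,y))$; (f) $l_2(w,l_3(x,y,z))-l_2(x,l_3(w,y,z))+l_2(y,l_3(w,x,z))+l_2(l_3(w,x,y),z)-l_3(l_2(w,x),y,z)-l_3(x,l_2(w,y),z)-l_3(x,y,l_2(w,z))+l_3(w,l_2(x,y),z)+l_3(w,y,l_2(x,z))-l_3(w,x,l_2(y,z))=0$. If $l_2$ and $l_3$ are skew-symmetric (including $l_2(x,m)=-l_2(m,x)$) it is a Lie 2-algebra. A CLWX 2-algebroid $(E_{-1},E_0,\partial,\rho,S,\diamond,\Omega)$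 over $M$ is a graded vector bundle $E_{-1}\oplus E_0$ with a nondegenerate symmetric bilinear form $S$, a bilinear operation $\diamond:\Gamma(E_{-i})\times\Gamma(E_{-j})\to\Gamma(E_{-(i+j)})$, $0\le i+j\le1$, skew-symmetric on $\Gamma(E_0)\times\Gamma(E_0)$, an $E_{-1}$-valued 3-form $\Omega$ on $E_0$, and bundle maps $\partial:E_{-1}\to E_0$, $\rho:E_0\to TM$, such that $E_{-1},E_0$ are isotropic and: (i) $(\Gamma(E_{-1}),\Gamma(E_0),\partial,\diamond,\Omega)$ is a Leibniz 2-algebra; (ii) $e\diamond e=\frac12\mathcal DS(e,e)$; (iii) $S(\partial e^1_1,e^1_2)=S(e^1_1,\partial e^1_2)$ for $e^1_i\in\Gamma(E_{-1})$; (iv) $\rho(e_1)S(e_2,e_3)=S(e_1\diamond e_2,e_3)+S(e_2,e_1\diamond e_3)$ ($\rho$ understood to vanish on $E_{-1}$); (v) $S(\Omega(e^0_1,e^0_2,e^0_3),e^0_4)=-S(e^0_3,\Omega(e^0_1,e^0_2,e^0_4))$; where $\mathcal D:C^\infty(M)\to\Gamma(E_{-1})$, $S(\mathcal Df,e^0)=\rho(e^0)(f)$. It is exact if $0\to T^*M\xrightarrow{\rho^*}E_{-1}\xrightarrow{\partial}E_0\xrightarrow{\rho}TM\to0$ is exact, where $S(\rho^*(\alpha),e^0)=\langle\alpha,\rho(e^0)\rangle$. A Lie 2-algebroid over $M$: graded vector bundle $A_{-1}\oplus A_0$, bundle map $\rho:A_0\to TM$, brackets making $(\Gamma(A_{-1})\oplus\Gamma(A_0);l_1,l_2,l_3)$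 a Lie 2-algebra, with $l_1,l_3$ $C^\infty(M)$-linear and $l_2(X^0,fY)=fl_2(X^0,Y)+\rho(X^0)(f)Y$ for $X^0\in\Gamma(A_0)$ and $Y$ a section of $A_0$ or $A_{-1}$. It is transitive if $\rho$ is surjective. A transitive one is quadratic if there is a degree 1 nondegenerate graded symmetric bilinear form $\mathcal S$ on $A_{-1}\oplus\ker\rho$ (pairing $A_{-1}$ with $\ker\rho$, zero on $A_{-1}\times A_{-1}$ and $\ker\rho\times\ker\rho$) with, for $u,v\in\Gamma(\ker\rho)$, $e^0,e^0_1,e^0_2\in\Gamma(A_0)$, $m,p\in\Gamma(A_{-1})$: $\mathcal S(l_1(m),p)=\mathcal S(m,l_1(p))$; $\rho(e^0)\mathcal S(u,m)=\mathcal S(l_2(e^0,u),m)+\mathcal S(u,l_2(e^0,m))$; $\mathcal S(l_3(e^0_1,e^0_2,u),v)=-\mathcal S(l_3(e^0_1,e^0_2,v),u)$. For the ample Lie 2-algebroid the form is the one induced by $S$: $\mathcal S(u,m)=S(u,\widetilde m)$. *)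

(* Defs.v *)
From HB Require Import structures.
From mathcomp Require Import all_boot all_order all_algebra.
From mathcomp Require Import all_classical all_reals all_analysis.
Set Implicit Arguments.
Unset Strict Implicit.
Unset Printing Implicit Defensive.
Import Order.TTheory GRing.Theory Num.Theory.
Import numFieldNormedType.Exports.
Local Open Scope classical_set_scope.
Local Open Scope ring_scope.
Local Open Scope quotient_scope.

(* Smooth functions on open subsets of R^n.  Only germs at the points of U are
   used, so f may be arbitrary outside U. *)
Fixpoint Ck (R : realType) (n k : nat) (U : set 'rV[R]_n) (f : 'rV[R]_n -> R)
    : Prop :=
  if k is k'.+1 then
    (forall x, U x -> differentiable f x) /\
    (forall v, Ck k' U (fun x => 'd f x v))
  else forall x, U x -> {for x, continuous f}.

Definition Cinfty (R : realType) (n : nat) (U : set 'rV[R]_n)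
  (f : 'rV[R]_n -> R) : Prop := forall k, Ck k U f.

Lemma near0_diff (R : numFieldType) (V W : normedModType R) (h : V -> W) (x : V) :
  (\forall y \near x, h y = 0) -> is_diff x h 0.
Proof.
move=> h0.
have hx : h x = 0 := nbhs_singleton h0.
have key : continuous (0 : V -> W) /\
    h \o shift x = cst (h x) + \0 +o_ 0 id.
  split; first exact: cst_continuous.
  apply/eqaddoE; rewrite hx addr0 funeqE => y /=.
  rewrite -[LHS]add0r; congr (_ + _).
  rewrite littleoE // => e e0.
  move: h0; rewrite (near_shift 0 x) /= => h0.
  near=> z; rewrite /= (_ : h (z + x) = 0) ?normr0; last first.
    by have : h (z + (x - 0)) = 0; [near: z | rewrite subr0].
  by rewrite mulr_ge0 // ltW.
have dh : 'd h x = \0 :> (V -> W) by apply/diff_unique; case: key.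
by apply: DiffDef => //; apply/diff_locallyP; rewrite dh.
Unshelve. all: by end_near. Qed.

Lemma near_is_diff (R : numFieldType) (V W : normedModType R) (f g df : V -> W)
  (x : V) : (\forall y \near x, f y = g y) -> is_diff x f df -> is_diff x g df.
Proof.
move=> fg dff.
have d0 : is_diff x (g - f) 0.
  apply: near0_diff; near=> y.
  by rewrite -[LHS]/(g y - f y) (_ : f y = g y) ?subrr //; near: y.
rewrite (_ : g = f + (g - f)); last by rewrite addrC subrK.
apply: (is_diff_eq (is_diffD dff d0)).
exact: addr0.
Unshelve. all: by end_near. Qed.

Section CinftyTheory.
Variables (R : realType) (n : nat).
Implicit Types (U : set 'rV[R]_n) (f g : 'rV[R]_n -> R).

Lemma Ck_ext k U f g : open U -> (forall x, U x -> f x = g x) ->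
  Ck k U f -> Ck k U g.
Proof.
move=> oU; have fgx f' g' x : (forall x, U x -> f' x = g' x) -> U x ->
    \forall y \near x, f' y = g' y :> R.
  by move=> fg Ux; near=> y; apply: fg; near: y; exact: open_nbhs_nbhs.
elim: k f g => [|k IH] f g fg /=.
  move=> cf x Ux; rewrite /prop_for /continuous_at -(fg x Ux).
  apply: cvg_trans (cf x Ux).
  exact: (near_eq_cvg (F := nbhs x) (fgx f g x fg Ux)).
move=> [df Cf].
have dg x : U x -> is_diff x g ('d f x).
  by move=> Ux; apply: near_is_diff (fgx _ _ _ fg Ux) _; apply/differentiableP/df.
split=> [x Ux|v]; first by have := dg x Ux => -[].
by apply: IH (Cf v) => x Ux; have [_ ->] := dg x Ux.
Unshelve. all: by end_near. Qed.

Lemma CkW k U f : Ck k.+1 U f -> Ck k U f.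
Proof.
elim: k f => [|k IH] f /= [df Cf].
  by move=> x Ux; exact/differentiable_continuous/df.
by split=> // v; exact/IH/Cf.
Qed.

Lemma Ck_cst k U (a : R) : Ck k U (fun=> a).
Proof.
elim: k a => [|k IH] a /=; first by move=> x _; exact: cst_continuous.
by split=> [x _|v] //; rewrite (_ : (fun _ => _) = fun=> 0) // funeqE => x;
  rewrite diff_cst.
Qed.

Lemma CkD k U f g : open U -> Ck k U f -> Ck k U g ->
  Ck k U (fun x => f x + g x).
Proof.
move=> oU; elim: k f g => [|k IH] f g /=.
  by move=> cf cg x Ux; apply: continuousD; [exact: cf|exact: cg].
move=> [df Cf] [dg Cg]; split=> [x Ux|v].
  by apply: differentiableD; [exact: df|exact: dg].
apply: (Ck_ext (f := fun x => 'd f x v + 'd g x v)) => // [x Ux|]; last exact: IH.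
by rewrite diffD; [|exact: df|exact: dg].
Qed.

Lemma CkM k U f g : open U -> Ck k U f -> Ck k U g ->
  Ck k U (fun x => f x * g x).
Proof.
move=> oU; elim: k f g => [|k IH] f g.
  by move=> cf cg x Ux; apply: (continuousM (cf x Ux) (cg x Ux)).
move=> Cf1 Cg1; have [df Cf] := Cf1; have [dg Cg] := Cg1.
split=> [x Ux|v]; first by apply: differentiableM; [exact: df|exact: dg].
apply: (Ck_ext (f := fun x => f x * 'd g x v + g x * 'd f x v)) => //.
  by move=> x Ux; rewrite diffM; [|exact: df|exact: dg].
by apply: CkD => //; apply: IH; [exact: CkW|exact: Cg|exact: CkW|exact: Cf].
Qed.

End CinftyTheory.

Record chart (R : realType) (n : nat) (M : topologicalType) := Chart {
  cdom : set M;
  cmap :> M -> 'rV[R]_n;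
  cinv : 'rV[R]_n -> M
}.

Definition is_chart (R : realType) (n : nat) (M : topologicalType)
    (c : chart R n M) : Prop :=
  [/\ open (cdom c), open (c @` cdom c), {in cdom c, cancel c (cinv c)},
      {in cdom c, continuous c} & {in c @` cdom c, continuous (cinv c)}].

Record manifold (R : realType) (n : nat) := Manifold {
  mspace :> topologicalType;
  mhausdorff : hausdorff_space mspace;
  msecond_countable : @second_countable mspace;
  atlas : set (chart R n mspace);
  atlas_chart : forall c, atlas c -> is_chart c;
  atlas_cover : forall p, exists2 c, atlas c & cdom c p;
  atlas_compat : forall c d, atlas c -> atlas d ->
    forall j, Cinfty (c @` (cdom c `&` cdom d)) (fun x => d (cinv c x) 0 j)
}.

Arguments atlas {R n} M c : rename.

Section Functions.
Variables (R : realType) (n : nat) (M : manifold R n).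

Definition msmooth (U : set M) (f : M -> R) : Prop :=
  forall c, atlas M c -> Cinfty (c @` (cdom c `&` U)) (f \o cinv c).

Lemma open_chart_image (c : chart R n M) (U : set M) :
  is_chart c -> open U -> open (c @` (cdom c `&` U)).
Proof.
case=> oD oI cK _ ci oU.
rewrite (_ : _ @` _ = c @` cdom c `&` cinv c @^-1` U); last first.
  apply/seteqP; split=> [_ [p [Dp Up] <-]|_ [[p Dp <-]]] /=.
    by split; [exists p|rewrite cK ?inE].
  by rewrite cK ?inE // => Up; exists p.
rewrite openE => x [Ix Ux]; apply: filterI; first exact: open_nbhs_nbhs.
by apply: ci; [rewrite inE|exact: open_nbhs_nbhs].
Qed.

Lemma msmooth_cst (U : set M) (a : R) : msmooth U (fun=> a).
Proof. by move=> c _ k; exact: Ck_cst. Qed.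

Lemma msmoothD (U : set M) (f g : M -> R) : open U ->
  msmooth U f -> msmooth U g -> msmooth U (fun p => f p + g p).
Proof.
move=> oU sf sg c cM k; apply: CkD; [|exact: sf|exact: sg].
exact: open_chart_image (atlas_chart cM) oU.
Qed.

Lemma msmoothM (U : set M) (f g : M -> R) : open U ->
  msmooth U f -> msmooth U g -> msmooth U (fun p => f p * g p).
Proof.
move=> oU sf sg c cM k; apply: CkM; [|exact: sf|exact: sg].
exact: open_chart_image (atlas_chart cM) oU.
Qed.

Lemma msmoothS (U V : set M) (f : M -> R) :
  U `<=` V -> msmooth V f -> msmooth U f.
Proof.
have CkS k (A B : set 'rV[R]_n) g : A `<=` B -> Ck k B g -> Ck k A g.
  move=> AB; elim: k g => [|k IH] g /=; first by move=> H x /AB; exact: H.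
  by move=> [dg Cg]; split=> [x /AB|v]; [exact: dg|exact/IH/Cg].
move=> UV sf c cM k; apply: CkS (sf c cM k).
by move=> _ [p [Dp Up] <-]; exists p => //; split=> //; exact: UV.
Qed.

Record smoothfun := SmoothFun {
  smoothfun_fun :> M -> R;
  smoothfunP : msmooth setT smoothfun_fun
}.

(* T_p M is represented by R^n in the coordinates of a chart chosen at p. *)
Definition chart_at (p : M) : chart R n M := s2val (cid2 (atlas_cover p)).

Definition dirder (p : M) (v : 'rV[R]_n) (f : M -> R) : R :=
  'd (f \o cinv (chart_at p)) (chart_at p p) v.

End Functions.

Arguments dirder {R n M} p v f.

(* Vector bundles.  The smooth structure of a bundle is given by its local
   trivializations; the total space is not formed. *)

Record local_triv (R : realType) (n : nat) (M : manifold R n)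
    (fib : M -> lmodType R) := LocalTriv {
  tdom : set M;
  tdom_open : open tdom;
  trank : nat;
  tmap : forall p, {linear fib p -> 'rV[R]_trank};
  tinv : forall p, 'rV[R]_trank -> fib p
}.

Arguments tmap {R n M fib} t p : rename.
Arguments tinv {R n M fib} t p v : rename.

Record bundle_data (R : realType) (n : nat) (M : manifold R n) := BundleData {
  fiber :> M -> lmodType R;
  trivs : set (local_triv fiber)
}.
Arguments trivs {R n M} E : rename.

Section Bundles.
Variables (R : realType) (n : nat) (M : manifold R n).
Implicit Types (E : bundle_data M).

(* The rank may differ between connected components of M. *)
Record vector_bundle E : Prop := VectorBundle {
  vb_cover : forall p, exists2 t, trivs E t & tdom t p;
  vb_tmapK : forall t p, trivs E t -> tdom t p ->
    cancel (tmap t p) (tinv t p) /\ cancel (tinv t p) (tmap t p);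
  vb_compat : forall t t', trivs E t -> trivs E t' ->
    forall (v : 'rV[R]_(trank t)) j,
    msmooth (tdom t `&` tdom t') (fun p => tmap t' p (tinv t p v) 0 j)
}.

Definition smooth_on E (U : set M) (s : forall p, E p) : Prop :=
  forall t, trivs E t -> forall j,
    msmooth (U `&` tdom t) (fun p => tmap t p (s p) 0 j).

Record Gamma E := GammaOf {
  Gamma_fun :> forall p, E p;
  GammaP : smooth_on setT Gamma_fun
}.

Lemma Gamma_ext E (s t : Gamma E) : (forall p, s p = t p) -> s = t.
Proof.
case: s t => [s Ps] [t Pt] /= st.
have {}st : s = t by apply: functional_extensionality_dep.
by case: _ / st in Pt *; congr GammaOf; exact: Prop_irrelevance.
Qed.

Lemma smooth_on0 E U : smooth_on U (fun p => 0 : E p).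
Proof.
move=> t _ j; rewrite (_ : (fun _ => _) = fun=> 0); first exact: msmooth_cst.
by rewrite funeqE => p; rewrite linear0 mxE.
Qed.

Lemma smooth_onD E U (s t : forall p, E p) : open U ->
  smooth_on U s -> smooth_on U t -> smooth_on U (fun p => s p + t p).
Proof.
move=> oU ss st u uE j.
rewrite (_ : (fun _ => _) =
    fun p => tmap u p (s p) 0 j + tmap u p (t p) 0 j).
  by apply: msmoothD; [exact/openI/tdom_open|exact: ss|exact: st].
by rewrite funeqE => p; rewrite linearD mxE.
Qed.

Lemma smooth_onM E U (f : M -> R) (s : forall p, E p) : open U ->
  msmooth U f -> smooth_on U s -> smooth_on U (fun p => f p *: s p).
Proof.
move=> oU sf ss u uE j.
rewrite (_ : (fun _ => _) = fun p => f p * tmap u p (s p) 0 j).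
  apply: msmoothM; [exact/openI/tdom_open| |exact: ss].
  by apply: msmoothS sf => p [].
by rewrite funeqE => p; rewrite linearZ mxE.
Qed.

Definition Gamma_zero E := GammaOf (@smooth_on0 E setT).
Definition Gamma_add E (s t : Gamma E) : Gamma E :=
  GammaOf (smooth_onD openT (GammaP s) (GammaP t)).
Definition fscale E (f : smoothfun M) (s : Gamma E) : Gamma E :=
  GammaOf (smooth_onM openT (smoothfunP f) (GammaP s)).
Definition Gamma_scale E (a : R) (s : Gamma E) : Gamma E :=
  fscale (SmoothFun (msmooth_cst setT a)) s.
Definition Gamma_opp E (s : Gamma E) : Gamma E := Gamma_scale (-1) s.

HB.instance Definition _ E := gen_eqMixin (Gamma E).
HB.instance Definition _ E := gen_choiceMixin (Gamma E).

Fact Gamma_addA E : associative (@Gamma_add E).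
Proof. by move=> x y z; apply: Gamma_ext => p /=; exact: addrA. Qed.
Fact Gamma_addC E : commutative (@Gamma_add E).
Proof. by move=> x y; apply: Gamma_ext => p /=; exact: addrC. Qed.
Fact Gamma_add0 E : left_id (@Gamma_zero E) (@Gamma_add E).
Proof. by move=> x; apply: Gamma_ext => p /=; exact: add0r. Qed.
Fact Gamma_addN E : left_inverse (@Gamma_zero E) (@Gamma_opp E) (@Gamma_add E).
Proof. by move=> x; apply: Gamma_ext => p /=; rewrite scaleN1r addNr. Qed.
HB.instance Definition _ E := GRing.isZmodule.Build (Gamma E)
  (@Gamma_addA E) (@Gamma_addC E) (@Gamma_add0 E) (@Gamma_addN E).

Fact Gamma_scaleA E (a b : R) (s : Gamma E) :
  Gamma_scale a (Gamma_scale b s) = Gamma_scale (a * b) s.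
Proof. by apply: Gamma_ext => p /=; exact: scalerA. Qed.
Fact Gamma_scale1 E : left_id 1 (@Gamma_scale E).
Proof. by move=> s; apply: Gamma_ext => p /=; exact: scale1r. Qed.
Fact Gamma_scaleDr E : right_distributive (@Gamma_scale E) +%R.
Proof. by move=> a s t; apply: Gamma_ext => p /=; exact: scalerDr. Qed.
Fact Gamma_scaleDl E (s : Gamma E) :
  {morph (@Gamma_scale E)^~ s : a b / a + b}.
Proof. by move=> a b; apply: Gamma_ext => p /=; exact: scalerDl. Qed.
HB.instance Definition _ E := GRing.Zmodule_isLmodule.Build R (Gamma E)
  (@Gamma_scaleA E) (@Gamma_scale1 E) (@Gamma_scaleDr E) (@Gamma_scaleDl E).

Record bundle_map E E' := BundleMap {
  bfun :> forall p, {linear E p -> E' p};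
  bfun_smooth : forall U (s : forall p, E p), open U -> smooth_on U s ->
    smooth_on U (fun p => bfun p (s p))
}.

Definition map_sec E E' (f : bundle_map E E') (s : Gamma E) : Gamma E' :=
  GammaOf (bfun_smooth f openT (GammaP s)).

Definition short_exact A B C (f : bundle_map A B) (g : bundle_map B C) : Prop :=
  forall p, [/\ injective (f p), range (f p) = [set b | g p b = 0]
              & range (g p) = setT].

Definition id_bmap E : bundle_map E E :=
  BundleMap (bfun := fun p => idfun) (fun U s _ ss => ss).

Definition zero_bmap E E' : bundle_map E E' :=
  BundleMap (bfun := fun p => \0 : {linear E p -> E' p})
    (fun U _ _ _ => @smooth_on0 E' U).

Definition zero_bundle : bundle_data M :=
  @BundleData R n M (fun=> 'rV[R]_0)
    [set @LocalTriv R n M (fun=> 'rV[R]_0) setT openT 0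
           (fun=> idfun) (fun=> idfun)].

Record form3 (E0 E1 : bundle_data M) := Form3 {
  form3_fun :> forall p, E0 p -> E0 p -> E0 p -> E1 p;
  form3_linear1 : forall p y z, linear (fun x => @form3_fun p x y z);
  form3_linear2 : forall p x z, linear (fun y => @form3_fun p x y z);
  form3_linear3 : forall p x y, linear (fun z => @form3_fun p x y z);
  form3_alt12 : forall p x z, @form3_fun p x x z = 0;
  form3_alt23 : forall p x y, @form3_fun p x y y = 0;
  form3_smooth : forall U (x y z : forall p, E0 p), open U ->
    smooth_on U x -> smooth_on U y -> smooth_on U z ->
    smooth_on U (fun p => @form3_fun p (x p) (y p) (z p))
}.

Definition form3_sec (E0 E1 : bundle_data M) (w : form3 E0 E1)
    (x y z : Gamma E0) : Gamma E1 :=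
  GammaOf (form3_smooth w openT (GammaP x) (GammaP y) (GammaP z)).

End Bundles.

Arguments form3_fun {R n M E0 E1} w p x y z : rename.

Section Tangent.
Variables (R : realType) (n : nat) (M : manifold R n).

(* v |-> Jacobian of the change from the chart chosen at p to the chart c *)
Definition tangent_triv (c : chart R n M) (cM : atlas M c) :
    local_triv (fun _ : M => 'rV[R]_n : lmodType R) :=
  LocalTriv (let: And5 oD _ _ _ _ := atlas_chart cM in oD)
    (fun p => 'd (c \o cinv (chart_at p)) (chart_at p p) :
       {linear 'rV[R]_n -> 'rV[R]_n})
    (fun p v => 'd (chart_at p \o cinv c) (c p) v).

Definition tangent : bundle_data M :=
  BundleData [set t | exists c (cM : atlas M c), t = tangent_triv cM].

Definition cotangent_fiber : lmodType R := 'Hom('rV[R]_n, R^o).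

Section Triv.
Variables (c : chart R n M) (cM : atlas M c) (p : M).

Definition cotangent_tmap (a : cotangent_fiber) : 'rV[R]_n :=
  \row_j (a (tinv (tangent_triv cM) p (delta_mx 0 j)) : R).

Fact cotangent_tmap_linear : linear cotangent_tmap.
Proof. by move=> k a b; apply/rowP => j; rewrite !mxE add_lfunE scale_lfunE. Qed.
HB.instance Definition _ := GRing.isLinear.Build R cotangent_fiber 'rV[R]_n
  *:%R cotangent_tmap cotangent_tmap_linear.

Definition cotangent_tinv (w : 'rV[R]_n) : cotangent_fiber :=
  linfun (fun v : 'rV[R]_n =>
    \sum_j w 0 j * tmap (tangent_triv cM) p v 0 j : R^o).

End Triv.

Definition cotangent_triv (c : chart R n M) (cM : atlas M c) :
    local_triv (fun _ : M => cotangent_fiber) :=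
  LocalTriv (tdom_open (tangent_triv cM))
    (fun p => cotangent_tmap cM p : {linear cotangent_fiber -> 'rV[R]_n})
    (cotangent_tinv cM).

Definition cotangent : bundle_data M :=
  BundleData [set t | exists c (cM : atlas M c), t = cotangent_triv cM].

Definition anchor_act (E : bundle_data M) (rho : bundle_map E tangent)
    (e : Gamma E) (f : M -> R) : M -> R :=
  fun p => dirder p (rho p (e p)) f.

End Tangent.

(* V / span K.  The span makes sense of the quotient for any set K; it is used
   below for K = rho^*(T^*_p M), which is a subspace as soon as the pairing S is
   bilinear and nondegenerate. *)
Section Quotient.
Variables (R : realType) (V : lmodType R).

Definition lspan (K : set V) : {pred V} := fun v =>
  `[< forall P : submodClosed V, (forall x, K x -> x \in P) -> v \in P >].

Lemma lspan_submod (K : set V) : submod_closed (lspan K).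
Proof.
split=> [|a u v /asboolP uK /asboolP vK]; apply/asboolP => P KP.
  exact: rpred0.
by apply: rpredD; [apply: rpredZ; exact: uK|exact: vK].
Qed.
HB.instance Definition _ (K : set V) :=
  GRing.isSubmodClosed.Build R V (lspan K)
    (lspan_submod K).

Variable K : set V.

Definition quot_mod := Quotient.quot (lspan K).
HB.instance Definition _ := GRing.Zmodule.on quot_mod.

Definition qpi (v : V) : quot_mod := \pi_(Quotient.quot (lspan K)) v.

Lemma qpiP (u v : V) : reflect (qpi u = qpi v) (u - v \in lspan K).
Proof. by rewrite Quotient.idealrBE; exact: eqP. Qed.

Lemma qpi_surj (x : quot_mod) : qpi (repr x) = x.
Proof. exact: reprK. Qed.

Definition quot_scale (a : R) (x : quot_mod) : quot_mod :=
  qpi (a *: repr (x : Quotient.quot (lspan K))).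

Lemma qpiD u v : qpi (u + v) = qpi u + qpi v.
Proof. exact: (raddfD \pi_(Quotient.quot (lspan K))). Qed.

Lemma qpi_scale a u : quot_scale a (qpi u) = qpi (a *: u).
Proof.
apply/qpiP; rewrite -scalerBr; apply: rpredZ; apply/qpiP; exact: qpi_surj.
Qed.

Fact quot_scaleA a b x : quot_scale a (quot_scale b x) = quot_scale (a * b) x.
Proof. by rewrite -(qpi_surj x) !qpi_scale scalerA. Qed.
Fact quot_scale1 : left_id 1 quot_scale.
Proof. by move=> x; rewrite -(qpi_surj x) !qpi_scale scale1r. Qed.
Fact quot_scaleDr : right_distributive quot_scale +%R.
Proof.
move=> a x y; rewrite -(qpi_surj x) -(qpi_surj y) -qpiD !qpi_scale.
by rewrite scalerDr qpiD.
Qed.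
Fact quot_scaleDl x : {morph quot_scale^~ x : a b / a + b}.
Proof. by move=> a b; rewrite -(qpi_surj x) !qpi_scale scalerDl qpiD. Qed.
HB.instance Definition _ := GRing.Zmodule_isLmodule.Build R quot_mod
  quot_scaleA quot_scale1 quot_scaleDr quot_scaleDl.

Fact qpi_linear : linear qpi.
Proof. by move=> a u v; rewrite qpiD -qpi_scale. Qed.
HB.instance Definition _ := GRing.isLinear.Build R V quot_mod *:%R qpi qpi_linear.

End Quotient.

(* Quotient of a vector bundle E by a family K of subspaces: its local
   trivializations are all those in which the projection E -> E / K is smooth *)
Section QuotientBundle.
Variables (R : realType) (n : nat) (M : manifold R n).
Variables (E : bundle_data M) (K : forall p, set (E p)).
Arguments K p _ : clear implicits.

Definition quot_fiber (p : M) : lmodType R := quot_mod (K p).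

Definition quot_trivs : set (local_triv quot_fiber) := [set t |
  (forall p, tdom t p ->
     cancel (tmap t p) (tinv t p) /\ cancel (tinv t p) (tmap t p)) /\
  (forall U (s : forall p, E p), open U -> smooth_on U s -> forall j,
     msmooth (U `&` tdom t) (fun p => tmap t p (qpi (K p) (s p)) 0 j))].

Definition quot_bundle : bundle_data M := BundleData quot_trivs.

Definition quot_proj : bundle_map E quot_bundle :=
  @BundleMap R n M E quot_bundle (fun p => qpi (K p))
    (fun U s oU ss t tE j => tE.2 U s oU ss j).

End QuotientBundle.

(* a product V_{-i} x V_{-j} -> V_{-i-j}, 0 <= i + j <= 1 *)
Record graded_op (V1 V0 : Type) := GradedOp {
  op00 : V0 -> V0 -> V0;
  op01 : V0 -> V1 -> V1;
  op10 : V1 -> V0 -> V1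
}.

Section Algebras.
Variables (R : realType) (V1 V0 : lmodType R).
Variables (d : V1 -> V0) (l2 : graded_op V1 V0) (l3 : V0 -> V0 -> V0 -> V1).

Local Notation l00 := (op00 l2).
Local Notation l01 := (op01 l2).
Local Notation l10 := (op10 l2).

Record leibniz2_algebra : Prop := Leibniz2Algebra {
  lb_d_linear : linear d;
  lb_00_linear1 : forall y, linear (fun x => l00 x y);
  lb_00_linear2 : forall x, linear (fun y => l00 x y);
  lb_01_linear1 : forall m, linear (fun x => l01 x m);
  lb_01_linear2 : forall x, linear (fun m => l01 x m);
  lb_10_linear1 : forall x, linear (fun m => l10 m x);
  lb_10_linear2 : forall m, linear (fun x => l10 m x);
  lb_l3_linear1 : forall y z, linear (fun x => l3 x y z);
  lb_l3_linear2 : forall x z, linear (fun y => l3 x y z);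
  lb_l3_linear3 : forall x y, linear (fun z => l3 x y z);
  lb_a : forall x m, d (l01 x m) = l00 x (d m);
  lb_b : forall m x, d (l10 m x) = l00 (d m) x;
  lb_c : forall m m', l01 (d m) m' = l10 m (d m');
  lb_d : forall x y z,
    d (l3 x y z) = l00 x (l00 y z) - l00 (l00 x y) z - l00 y (l00 x z);
  lb_e1 : forall x y m,
    l3 x y (d m) = l01 x (l01 y m) - l01 (l00 x y) m - l01 y (l01 x m);
  lb_e2 : forall x m y,
    l3 x (d m) y = l01 x (l10 m y) - l10 (l01 x m) y - l10 m (l00 x y);
  lb_e3 : forall m x y,
    l3 (d m) x y = l10 m (l00 x y) - l10 (l10 m x) y - l01 x (l10 m y);
  lb_f : forall w x y z,
    l01 w (l3 x y z) - l01 x (l3 w y z) + l01 y (l3 w x z) + l10 (l3 w x y) z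
    - l3 (l00 w x) y z - l3 x (l00 w y) z - l3 x y (l00 w z)
    + l3 w (l00 x y) z + l3 w y (l00 x z) - l3 w x (l00 y z) = 0
}.

Record lie2_algebra : Prop := Lie2Algebra {
  lie2_leibniz : leibniz2_algebra;
  lie2_skew00 : forall x y, l00 x y = - l00 y x;
  lie2_skew01 : forall x m, l01 x m = - l10 m x;
  lie2_skew_l3_12 : forall x y z, l3 x y z = - l3 y x z;
  lie2_skew_l3_23 : forall x y z, l3 x y z = - l3 x z y
}.

(* the product on V_{-1} + V_0; it vanishes on V_{-1} x V_{-1} *)
Definition total_op (a b : V1 * V0) : V1 * V0 :=
  (l01 a.2 b.1 + l10 a.1 b.2, l00 a.2 b.2).

End Algebras.

(* Nondegenerate symmetric bilinear forms on E1 + W, for a family W of subspaces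
   of E0, that pair E1 with W (E1 in degree -1, E0 in degree 0); such a form is
   given by functions on E1 + E0, whose values outside E1 + W are irrelevant *)
Section GradedForm.
Variables (R : realType) (n : nat) (M : manifold R n) (E1 E0 : bundle_data M).

Record graded_form (W : forall p, set (E0 p))
    (S : forall p, E1 p * E0 p -> E1 p * E0 p -> R) : Prop := GradedForm {
  gf_linear : forall p k (a b c : E1 p * E0 p), W p a.2 -> W p b.2 -> W p c.2 ->
    S p a (k *: b + c) = k * S p a b + S p a c;
  gf_sym : forall p (a b : E1 p * E0 p), W p a.2 -> W p b.2 ->
    S p a b = S p b a;
  gf_nondeg : forall p (a : E1 p * E0 p), W p a.2 ->
    (forall b, W p b.2 -> S p a b = 0) -> a = 0;
  gf_isotropic1 : forall p (m m' : E1 p), S p (m, 0) (m', 0) = 0;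
  gf_isotropic0 : forall p (u v : E0 p), W p u -> W p v ->
    S p (0, u) (0, v) = 0;
  gf_smooth : forall U (m m' : forall p, E1 p) (u v : forall p, E0 p), open U ->
    smooth_on U m -> smooth_on U m' -> smooth_on U u -> smooth_on U v ->
    (forall p, U p -> W p (u p)) -> (forall p, U p -> W p (v p)) ->
    msmooth U (fun p => S p (m p, u p) (m' p, v p))
}.

Definition form_sec (S : forall p, E1 p * E0 p -> E1 p * E0 p -> R)
    (a b : Gamma E1 * Gamma E0) : M -> R :=
  fun p => S p (a.1 p, a.2 p) (b.1 p, b.2 p).

End GradedForm.

Section CLWX.
Variables (R : realType) (n : nat) (M : manifold R n) (E1 E0 : bundle_data M).
Variables (d : bundle_map E1 E0) (rho : bundle_map E0 (tangent M)).
Variable S : forall p, E1 p * E0 p -> E1 p * E0 p -> R.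
Variables (dia : graded_op (Gamma E1) (Gamma E0)) (Om : form3 E0 E1).

(* Nondegeneracy of S makes the elements chosen by [xget] unique. *)
Definition clwx_D (f : M -> R) : Gamma E1 :=
  xget 0 [set s : Gamma E1 | forall e : Gamma E0,
    form_sec S (s, 0) (0, e) = anchor_act rho e f].

Definition rho_star (p : M) (a : cotangent M p) : E1 p :=
  xget 0 [set x : E1 p | forall e : E0 p,
    S (x, 0) (0, e) = (a : 'Hom('rV[R]_n, R^o)) (rho p e)].

Record clwx2_algebroid : Prop := CLWX2Algebroid {
  clwx_bundle1 : vector_bundle E1;
  clwx_bundle0 : vector_bundle E0;
  clwx_form : graded_form (fun=> setT) S;
  clwx_skew : forall x y, op00 dia x y = - op00 dia y x;
  clwx_leibniz2 : leibniz2_algebra (map_sec d) dia (form3_sec Om);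
  clwx_square : forall e,
    total_op dia e e = (2^-1 *: clwx_D (form_sec S e e), 0);
  clwx_d_sym : forall m m' : Gamma E1,
    form_sec S (0, map_sec d m) (m', 0) = form_sec S (m, 0) (0, map_sec d m');
  clwx_invariant : forall e1 e2 e3 : Gamma E1 * Gamma E0,
    anchor_act rho e1.2 (form_sec S e2 e3) =
    (fun p => form_sec S (total_op dia e1 e2) e3 p
            + form_sec S e2 (total_op dia e1 e3) p);
  clwx_Om_skew : forall x y z w : Gamma E0,
    form_sec S (form3_sec Om x y z, 0) (0, w) =
    (fun p => - form_sec S (0, z) (form3_sec Om x y w, 0) p)
}.

Record exact_clwx2_algebroid : Prop := ExactCLWX2Algebroid {
  exact_clwx : clwx2_algebroid;
  exact_rho_star : forall p, injective (@rho_star p);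
  exact_E1 : forall p, range (@rho_star p) = [set m | d p m = 0];
  exact_E0 : forall p, range (d p) = [set e | rho p e = 0];
  exact_T : forall p, range (rho p) = setT
}.

End CLWX.

Section Lie2Algebroid.
Variables (R : realType) (n : nat) (M : manifold R n) (A1 A0 : bundle_data M).
Variables (rho : bundle_map A0 (tangent M)) (l1 : Gamma A1 -> Gamma A0).
Variables (l2 : graded_op (Gamma A1) (Gamma A0)).
Variables (l3 : Gamma A0 -> Gamma A0 -> Gamma A0 -> Gamma A1).

Record lie2_algebroid : Prop := Lie2Algebroid {
  la_bundle1 : vector_bundle A1;
  la_bundle0 : vector_bundle A0;
  la_lie2 : lie2_algebra l1 l2 l3;
  la_l1_linear : forall (f : smoothfun M) m, l1 (fscale f m) = fscale f (l1 m);
  la_l3_linear1 : forall (f : smoothfun M) x y z,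
    l3 (fscale f x) y z = fscale f (l3 x y z);
  la_l3_linear2 : forall (f : smoothfun M) x y z,
    l3 x (fscale f y) z = fscale f (l3 x y z);
  la_l3_linear3 : forall (f : smoothfun M) x y z,
    l3 x y (fscale f z) = fscale f (l3 x y z);
  la_anchor00 : forall (f : smoothfun M) x y p,
    op00 l2 x (fscale f y) p = f p *: op00 l2 x y p + anchor_act rho x f p *: y p;
  la_anchor01 : forall (f : smoothfun M) x m p,
    op01 l2 x (fscale f m) p = f p *: op01 l2 x m p + anchor_act rho x f p *: m p
}.

Definition ker_rho (p : M) : set (A0 p) := [set e | rho p e = 0].

Definition in_ker (u : Gamma A0) : Prop := forall p, ker_rho (u p).

(* [quad_l1_ker] and [quad_l2_ker] make the terms of the conditions after them
   values of the form on A1 + ker rho. *)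
Record quadratic_lie2_algebroid
    (S : forall p, A1 p * A0 p -> A1 p * A0 p -> R) : Prop :=
    QuadraticLie2Algebroid {
  quad_lie2_algebroid : lie2_algebroid;
  quad_transitive : forall p, range (rho p) = setT;
  quad_form : graded_form ker_rho S;
  quad_l1_ker : forall m, in_ker (l1 m);
  quad_l2_ker : forall x u, in_ker u -> in_ker (op00 l2 x u);
  quad_l1_sym : forall m m' : Gamma A1,
    form_sec S (0, l1 m) (m', 0) = form_sec S (m, 0) (0, l1 m');
  quad_invariant : forall x u m, in_ker u ->
    anchor_act rho x (form_sec S (0, u) (m, 0)) =
    (fun p => form_sec S (0, op00 l2 x u) (m, 0) p
            + form_sec S (0, u) (op01 l2 x m, 0) p);
  quad_l3_skew : forall x y u v, in_ker u -> in_ker v ->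
    form_sec S (l3 x y u, 0) (0, v) =
    (fun p => - form_sec S (l3 x y v, 0) (0, u) p)
}.

End Lie2Algebroid.

Section Ample.
Variables (R : realType) (n : nat) (M : manifold R n) (E1 E0 : bundle_data M).
Variables (d : bundle_map E1 E0) (rho : bundle_map E0 (tangent M)).
Variable S : forall p, E1 p * E0 p -> E1 p * E0 p -> R.
Variables (dia : graded_op (Gamma E1) (Gamma E0)) (Om : form3 E0 E1).

Definition ample_F : bundle_data M :=
  quot_bundle (fun p => range (@rho_star R n M E1 E0 rho S p)).

Definition ample_pr : bundle_map E1 ample_F :=
  quot_proj (fun p => range (@rho_star R n M E1 E0 rho S p)).

Definition ample_structure (l1 : bundle_map ample_F E0)
    (l2 : graded_op (Gamma ample_F) (Gamma E0))
    (l3 : Gamma E0 -> Gamma E0 -> Gamma E0 -> Gamma ample_F)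
    (SF : forall p, ample_F p * E0 p -> ample_F p * E0 p -> R) : Prop :=
  [/\ forall p (m : E1 p), l1 p (ample_pr p m) = d p m,
      forall x y, op00 l2 x y = op00 dia x y,
      forall (m : Gamma ample_F) (mt : Gamma E1), map_sec ample_pr mt = m ->
        forall x, op01 l2 x m = map_sec ample_pr (op01 dia x mt) /\
                  op10 l2 m x = map_sec ample_pr (op10 dia mt x),
      forall x y z, l3 x y z = map_sec ample_pr (form3_sec Om x y z)
    & forall p (u : E0 p) (m : E1 p), rho p u = 0 ->
        SF p (0, u) (ample_pr p m, 0) = S (0, u) (m, 0)].

(* the diagram with rows T^*[1]M -> E1 -> F and 0 -> E0 -> E0 *)
Definition clwx_extension (l1 : bundle_map ample_F E0) : Prop :=
  exists rs : bundle_map (cotangent M) E1,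
  [/\ forall p a, rs p a = rho_star rho S a,
      short_exact rs ample_pr,
      short_exact (zero_bmap (zero_bundle M) E0) (id_bmap E0),
      forall p a, d p (rs p a) =
        zero_bmap (zero_bundle M) E0 p (zero_bmap (cotangent M) (zero_bundle M) p a)
    & forall p m, l1 p (ample_pr p m) = id_bmap E0 p (d p m)].

End Ample.

(* Main.v *)
Require Import Defs.
From HB Require Import structures.
From mathcomp Require Import all_boot all_order all_algebra.
From mathcomp Require Import all_classical all_reals all_analysis.
From mathcomp Require Import ring lra.
Set Implicit Arguments.
Unset Strict Implicit.
Unset Printing Implicit Defensive.
Import Order.TTheory GRing.Theory Num.Theory.
Import numFieldNormedType.Exports.
Local Open Scope classical_set_scope.
Local Open Scope ring_scope.

(** Exactness says that [d] kills exactly the image of the cotangent bundle, so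
    two elements of [E1] have the same class in [F = ample_F rho S] if and only
    if [d] takes the same value on them ([pr_eqP]), and the map [l1] induced by
    [d] identifies [F] with the kernel of the anchor. This carries the algebra.
    The products descend to [F] because [d (x . m) = x . d m] depends only on
    the class of [m]; the identities of a Leibniz 2-algebra are inherited along the
    surjection [pr]; and skew-symmetry in mixed degree holds because [l1] is
    injective and [d (x . m + m . x) = x . d m + d m . x = 0]. The Leibniz rule
    for the anchor is read off from the invariance of [S], which is
    nondegenerate ([dia_anchor]). A covector [a] satisfies
    [S (rho^* a, u) = a (rho u)], so [S] descends to a pairing of [F] with the
    kernel of the anchor; it stays nondegenerate because a vector pairing to
    zero with the whole kernel is the image of a covector ([pairing_ker_eq0]).
    The kernel is an ideal because all its sections are of the form [d m]
    ([ker_rho_lift]).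

    The analytic content is that [F] is a vector bundle whose sections, as well
    as those of the kernel of the anchor, lift to sections of [E1]. The anchor
    is onto, so its kernel has locally constant rank and [F] is locally trivial
    ([ample_triv]). Lifts exist locally because a smooth family of linear maps
    that is onto at a point has a smooth right inverse nearby
    ([local_right_inverse]), and local lifts are averaged with locally finite
    smooth weights ([weights_exist], [global_solution]). *)

(** * Smooth functions of one variable *)

(** The one-variable counterpart of [Ck]. Derivatives are given by witnesses, so
    that a family of explicit functions can be handled by a single induction. *)
Fixpoint Ck1 (R : realType) (k : nat) (I : set R) (phi : R -> R) : Prop :=
  if k is k'.+1 then
    exists2 dphi : R -> R, (forall t, I t -> is_derive t 1 phi (dphi t)) &
      Ck1 k' I dphi
  else forall t, I t -> {for t, continuous phi}.

Section OneVariable.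
Variable R : realType.
Implicit Types (I : set R) (phi psi : R -> R).

Lemma Ck1D k I phi psi : Ck1 k I phi -> Ck1 k I psi -> Ck1 k I (phi + psi).
Proof.
elim: k phi psi => [|k IH] phi psi /=.
  by move=> cphi cpsi t It; apply: continuousD; [exact: cphi|exact: cpsi].
move=> [dphi phiP Cphi] [dpsi psiP Cpsi]; exists (dphi + dpsi); last exact: IH.
by move=> t It; apply: is_deriveD; [exact: phiP|exact: psiP].
Qed.

Lemma Ck1Z k I (a : R) phi : Ck1 k I phi -> Ck1 k I (a \*: phi).
Proof.
elim: k phi => [|k IH] phi /=.
  by move=> cphi t It; apply: continuousZr; exact: cphi.
move=> [dphi phiP Cphi]; exists (a \*: dphi); last exact: IH.
by move=> t It; apply: is_deriveZ; exact: phiP.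
Qed.

Lemma powV_is_derive m (t : R) : t != 0 ->
  is_derive t 1 (fun t : R => t ^- m) ((- m%:R) * t ^- m.+1).
Proof.
move=> t0; have tm0 : t ^+ m != 0 by rewrite expf_neq0.
have dX : is_derive t 1 ((@id R) ^+ m) ((m%:R * t ^+ m.-1) *: 1).
  exact: is_deriveX.
rewrite (_ : id ^+ m = fun x => x ^+ m) in dX; last first.
  by rewrite funeqE => x; rewrite fctE.
have dV := is_deriveV (f := fun x : R => x ^+ m) tm0 dX.
apply: is_derive_eq dV _.
rewrite /GRing.scale /= mulr1 !mulNr; congr (- _).
case: m {dX tm0} => [|m]; first by rewrite !mul0r mulr0.
by rewrite /= !exprS; field; rewrite t0 expf_neq0.
Qed.

Lemma Ck1_powV k m : Ck1 k [set t : R | t != 0] (fun t => t ^- m).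
Proof.
elim: k m => [|k IH] m /=.
  move=> t t0; apply: differentiable_continuous; apply/derivable1_diffP.
  by have [] := powV_is_derive m t0.
exists ((- m%:R) \*: (fun t => t ^- m.+1)) => [t t0|].
  exact: powV_is_derive.
exact/Ck1Z/IH.
Qed.

(** The factors [t ^- m] make the family stable under differentiation, up to
    linear combinations. *)
Definition flat (m : nat) (t : R) : R :=
  if 0 < t then t ^- m * expR (- t^-1) else 0.

Lemma flat_gt0 m t : (0 < flat m t) = (0 < t).
Proof.
rewrite /flat; case: ifPn => [t0|]; last by rewrite ltxx.
by rewrite mulr_gt0 ?expR_gt0 // invr_gt0 exprn_gt0.
Qed.

Lemma flat_ge0 m t : 0 <= flat m t.
Proof.
rewrite /flat; case: ifPn => // t0.
by rewrite mulr_ge0 ?expR_ge0 // invr_ge0 exprn_ge0 // ltW.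
Qed.

(** The exponential beats every power, so [flat m] vanishes to second order at
    0, which is what its derivative at 0 needs. *)
Lemma flat_le m t : flat m t <= (m.+2)`!%:R * t ^+ 2.
Proof.
have C0 : 0 < (m.+2)`!%:R :> R by rewrite ltr0n fact_gt0.
rewrite /flat; case: ifPn => [t0|_]; last first.
  by rewrite mulr_ge0 ?sqr_ge0 ?ltW.
have tV0 : 0 <= t^-1 by rewrite invr_ge0 ltW.
have := expR_ge1Dxn m.+1 tV0; set e := expR t^-1 => he.
have {}he : t^-1 ^+ m.+2 / (m.+2)`!%:R <= e.
  by apply: le_trans he; rewrite lerDr.
have e0 : 0 < e by exact: expR_gt0.
(* multiplied by e = exp (1 / t), the claim follows from the lower bound on e *)
rewrite expRN -/e -(ler_pM2r e0) mulfVK ?gt_eqF //.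
apply: (@le_trans _ _ ((m.+2)`!%:R * t ^+ 2 * (t^-1 ^+ m.+2 / (m.+2)`!%:R))).
  rewrite exprVn !exprS.
  have tm : t ^+ m != 0 by rewrite expf_neq0 // gt_eqF.
  by rewrite le_eqVlt; apply/orP; left; apply/eqP; field; rewrite tm !gt_eqF.
by rewrite ler_pM2l // mulr_gt0 // exprn_gt0.
Qed.

Lemma flat_is_derive m (t : R) :
  is_derive t 1 (flat m) ((- m%:R) * flat m.+1 t + flat m.+2 t).
Proof.
have [t0|t0|->] := ltgtP t 0.
- have -> : (- m%:R) * flat m.+1 t + flat m.+2 t = 0.
    by rewrite /flat lt_gtF // mulr0 addr0.
  apply: (@near_eq_is_derive _ _ _ (cst (0 : R))).
  by near=> x; rewrite /flat /cst lt_gtF //; near: x; exact: lt_nbhsl.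
- pose g : R -> R := (fun t => t ^- m) * (expR \o (fun t => - t^-1)).
  apply: (@near_eq_is_derive _ _ _ g).
    near=> x; rewrite /flat /g !fctE /=.
    by have -> : 0 < x by near: x; exact: lt_nbhsr.
  have tN0 : t != 0 by rewrite gt_eqF.
  have d1 := powV_is_derive m tN0.
  have d2 : is_derive t 1 (fun t : R => - t^-1) (t ^- 2).
    rewrite (_ : (fun t => _) = - (fun t => t ^- 1)); last first.
      by rewrite funeqE.
    apply: is_derive_eq (is_deriveN (powV_is_derive 1 tN0)) _.
    by rewrite mulN1r opprK.
  have d3 := is_derive1_comp (is_derive_expR _) d2.
  apply: is_derive_eq (is_deriveM d1 d3) _.
  rewrite /flat t0 /= /GRing.scale /= !exprS.
  by field; rewrite expf_neq0 ?tN0.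
- have -> : (- m%:R) * flat m.+1 0 + flat m.+2 0 = 0.
    by rewrite /flat ltxx mulr0 addr0.
  set C : R := (m.+2)`!%:R.
  have cC : (fun h : R => C * `|h|) @ 0^' --> C * `|0 : R|.
    by apply: cvgM; [exact: cvg_cst|apply: cvg_norm; exact: nbhs_dnbhs].
  rewrite normr0 mulr0 in cC.
  have q0 : (fun h : R => h^-1 *: ((flat m \o shift 0) (h *: 1) - flat m 0)) @
      0^' --> (0 : R).
    apply: norm_cvg0; apply: (squeeze_cvgr (f := cst 0) _ (cvg_cst _) cC).
    near=> h.
    have h0 : h != 0 by near: h; exact: nbhs_dnbhs_neq.
    rewrite normr_ge0 /= /GRing.scale /= mulr1 addr0 {2}/flat ltxx subr0.
    rewrite normrM normfV (ger0_norm (flat_ge0 _ _)) mulrC.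
    rewrite ler_pdivrMr ?normr_gt0 // -mulrA -expr2 real_normK ?num_real //.
    exact: flat_le.
  by split; [apply/cvg_ex; exists 0|exact: cvg_lim q0].
Unshelve. all: by end_near. Qed.

Lemma Ck1_flat k m : Ck1 k setT (flat m).
Proof.
elim: k m => [|k IH] m /=.
  move=> t _; apply: differentiable_continuous; apply/derivable1_diffP.
  by have [] := flat_is_derive m t.
exists ((- m%:R) \*: flat m.+1 + flat m.+2).
  by move=> t _; exact: flat_is_derive.
by apply: Ck1D => //; exact: Ck1Z.
Qed.

Lemma Ck_comp1 n k (U : set 'rV[R]_n) I phi f : open U ->
  (forall x, U x -> I (f x)) -> Ck1 k I phi -> Ck k U f -> Ck k U (phi \o f).
Proof.
move=> oU UI; elim: k phi => [|k IH] phi.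
  by move=> cphi cf x Ux; apply: continuous_comp; [exact: cf|exact/cphi/UI].
move=> [dphi phiP Cphi] Cf; have [df Cdf] := Cf.
have dphix x : U x -> differentiable phi (f x).
  by move=> Ux; apply/derivable1_diffP; have [] := phiP _ (UI x Ux).
split=> [x Ux|v].
  by apply: differentiable_comp; [exact: (df x Ux)|exact: (dphix x Ux)].
apply: (Ck_ext (f := fun x => (dphi \o f) x * 'd f x v)) => //.
  move=> x Ux; rewrite (diff_comp (df x Ux) (dphix x Ux)).
  rewrite /= diff1E; last exact: dphix.
  by have [_ e] := phiP _ (UI x Ux); rewrite derive1E e /GRing.scale /= mulrC.
apply: CkM => //; first by apply: IH => //; exact: CkW.
exact: Cdf.
Qed.

End OneVariable.

(** * Smooth functions on a manifold *)

(** [Ck] only involves germs at the points of the set. *)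
Lemma Ck_local (R : realType) n k (U : set 'rV[R]_n) f :
  (forall x, U x -> exists2 W, W x & Ck k W f) -> Ck k U f.
Proof.
elim: k f => [|k IH] f /= UP; first by move=> x /UP [W Wx]; exact.
split=> [x /UP [W Wx [df _]]|v]; first exact: df.
by apply: IH => x /UP [W Wx [_ Cf]]; exists W.
Qed.

Section SmoothFunctions.
Variables (R : realType) (n : nat) (M : manifold R n).
Implicit Types (U W : set M) (f g : M -> R) (p : M).

Lemma msmooth_local U f :
  (forall p, U p -> exists2 W, W p & msmooth W f) -> msmooth U f.
Proof.
move=> UP c cM k; apply: Ck_local => _ [p [Dp /UP [W Wp sf]] <-].
by exists (c @` (cdom c `&` W)); [exists p|exact: sf].
Qed.

Lemma msmooth_ext U f g : open U -> (forall p, U p -> f p = g p) ->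
  msmooth U f -> msmooth U g.
Proof.
move=> oU fg sf c cM k; have cc := atlas_chart cM; have [_ _ cK _ _] := cc.
apply: (Ck_ext (open_chart_image cc oU)) (sf c cM k) => _ [p [Dp Up] <-] /=.
by rewrite cK ?inE //; exact: fg.
Qed.

Lemma msmoothZ U (a : R) f : open U -> msmooth U f ->
  msmooth U (fun p => a * f p).
Proof. by move=> oU; apply: msmoothM => //; exact: msmooth_cst. Qed.

Lemma msmoothN U f : open U -> msmooth U f -> msmooth U (fun p => - f p).
Proof.
move=> oU /(msmoothZ (-1) oU); apply: msmooth_ext => // p _.
by rewrite mulN1r.
Qed.

Lemma msmoothB U f g : open U -> msmooth U f -> msmooth U g ->
  msmooth U (fun p => f p - g p).
Proof. by move=> oU sf sg; apply: msmoothD => //; exact: msmoothN. Qed.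

Lemma msmooth_sum U I (r : seq I) (P : pred I) (F : I -> M -> R) : open U ->
  (forall i, P i -> msmooth U (F i)) ->
  msmooth U (fun p => \sum_(i <- r | P i) F i p).
Proof.
move=> oU sF; elim: r => [|i r IH].
  by apply: msmooth_ext (msmooth_cst U 0) => // p _; rewrite big_nil.
case Pi: (P i); last first.
  by apply: msmooth_ext IH => // p _; rewrite big_cons Pi.
apply: msmooth_ext (msmoothD oU (sF i Pi) IH) => // p _.
by rewrite big_cons Pi.
Qed.

Lemma msmooth_prod U I (r : seq I) (P : pred I) (F : I -> M -> R) : open U ->
  (forall i, P i -> msmooth U (F i)) ->
  msmooth U (fun p => \prod_(i <- r | P i) F i p).
Proof.
move=> oU sF; elim: r => [|i r IH].
  by apply: msmooth_ext (msmooth_cst U 1) => // p _; rewrite big_nil.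
case Pi: (P i); last first.
  by apply: msmooth_ext IH => // p _; rewrite big_cons Pi.
apply: msmooth_ext (msmoothM oU (sF i Pi) IH) => // p _.
by rewrite big_cons Pi.
Qed.

Lemma msmooth_comp1 U (I : set R) phi f : open U ->
  (forall p, U p -> I (f p)) -> (forall k, Ck1 k I phi) ->
  msmooth U f -> msmooth U (phi \o f).
Proof.
move=> oU UI Cphi sf c cM k; have cc := atlas_chart cM.
have [_ _ cK _ _] := cc.
apply: (Ck_comp1 (open_chart_image cc oU) _ (Cphi k) (sf c cM k)).
by move=> _ [p [Dp Up] <-] /=; rewrite cK ?inE //; exact: UI.
Qed.

Lemma msmoothV U f : open U -> (forall p, U p -> f p != 0) ->
  msmooth U f -> msmooth U (fun p => (f p)^-1).
Proof.
move=> oU f0 sf; apply: (msmooth_comp1 oU (phi := fun t => t ^- 1) f0) sf => k.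
exact: Ck1_powV.
Qed.

Lemma msmooth_flat U m f : open U -> msmooth U f ->
  msmooth U (fun p => flat m (f p)).
Proof.
by move=> oU; apply: (@msmooth_comp1 U setT) => // k; exact: Ck1_flat.
Qed.

Lemma msmooth_continuous U f p : open U -> U p -> msmooth U f ->
  {for p, continuous f}.
Proof.
move=> oU Up sf; have [c cM Dp] := atlas_cover p.
have [oD _ cK cc _] := atlas_chart cM.
have sf0 := sf c cM 0%N; rewrite /= in sf0.
have {}sf0 : {for c p, continuous (f \o cinv c)} by apply: (sf0 (c p)); exists p.
have cp : {for p, continuous c} by exact: (cc p (mem_set Dp)).
have h : {for p, continuous ((f \o cinv c) \o c)} by exact: continuous_comp.
rewrite /prop_for /continuous_at /= cK ?inE // in h.
rewrite /prop_for /continuous_at.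
apply: cvg_trans h; apply: (near_eq_cvg (F := nbhs p)).
near=> q; rewrite /= cK // inE; near: q; exact: open_nbhs_nbhs.
Unshelve. all: by end_near. Qed.

Lemma chart_coord_smooth (c : chart R n M) : atlas M c ->
  forall j, msmooth (cdom c) (fun p => c p 0 j).
Proof. by move=> cM j d dM; exact: atlas_compat. Qed.

Lemma chart_at_atlas p : atlas M (chart_at p).
Proof. exact: (s2valP (cid2 (atlas_cover p))). Qed.

Lemma chart_at_dom p : cdom (chart_at p) p.
Proof. exact: (s2valP' (cid2 (atlas_cover p))). Qed.

Lemma chart_atK p : cinv (chart_at p) (chart_at p p) = p.
Proof.
have [_ _ cK _ _] := atlas_chart (chart_at_atlas p).
by apply: cK; rewrite inE; exact: chart_at_dom.
Qed.

Lemma msmooth_differentiable U f (c : chart R n M) p : atlas M c ->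
  cdom c p -> U p -> msmooth U f -> differentiable (f \o cinv c) (c p).
Proof.
move=> cM Dp Up sf; have [df _] := sf c cM 1%N.
by apply: df; exists p.
Qed.

Lemma dirderM p v f g : msmooth setT f -> msmooth setT g ->
  dirder p v (fun q => f q * g q) = f p * dirder p v g + dirder p v f * g p.
Proof.
move=> sf sg; rewrite /dirder.
have df := msmooth_differentiable (chart_at_atlas p) (chart_at_dom p) I sf.
have dg := msmooth_differentiable (chart_at_atlas p) (chart_at_dom p) I sg.
have -> : (fun q => f q * g q) \o cinv (chart_at p) =
    (f \o cinv (chart_at p)) * (g \o cinv (chart_at p)) by [].
rewrite (diffM df dg) /= chart_atK.
by congr (_ + _); exact: mulrC.
Qed.

End SmoothFunctions.

(** * Jacobians of chart changes *)

Section Jacobians.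
Variables (R : realType) (n : nat) (M : manifold R n).

Lemma chart_change_differentiable (c e : chart R n M) p : atlas M c ->
  atlas M e -> cdom c p -> cdom e p -> differentiable (e \o cinv c) (c p).
Proof.
move=> cM eM cp ep.
have -> : e \o cinv c =
    \sum_(j < n) (fun x => e (cinv c x) 0 j *: delta_mx 0 j : 'rV[R]_n).
  by rewrite funeqE => x; rewrite fct_sumE /= [LHS]row_sum_delta.
apply: differentiable_sum => j; apply: differentiableZl.
exact: (msmooth_differentiable cM cp ep (chart_coord_smooth eM j)).
Qed.

(** The chain rule, the two changes of charts being inverse to each other near
    the point. *)
Lemma Jacobian_inv (c e : chart R n M) p (v : 'rV[R]_n) : atlas M c ->
  atlas M e -> cdom c p -> cdom e p ->
  'd (c \o cinv e) (e p) ('d (e \o cinv c) (c p) v) = v.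
Proof.
move=> cM eM cp ep; have [oDc _ cK _ _] := atlas_chart cM.
have [oDe _ eK _ _] := atlas_chart eM.
have dF := chart_change_differentiable cM eM cp ep.
have eF : (e \o cinv c) (c p) = e p by rewrite /= cK ?inE.
have dG : differentiable (c \o cinv e) ((e \o cinv c) (c p)).
  by rewrite eF; exact: chart_change_differentiable.
have h := diff_comp dF dG; rewrite eF in h.
have [_ did] : is_diff (c p) ((c \o cinv e) \o (e \o cinv c)) (@id 'rV[R]_n).
  apply: (near_is_diff (f := id)) => //.
  have oI := open_chart_image (atlas_chart cM) oDe.
  near=> x.
  have : (c @` (cdom c `&` cdom e)) x.
    by near: x; apply: open_nbhs_nbhs; split=> //; exists p.
  by move=> [q [cq eq] <-] /=; rewrite cK ?inE // eK ?inE.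
by rewrite -[LHS]/(('d (c \o cinv e) (e p) \o 'd (e \o cinv c) (c p)) v) -h did.
Unshelve. all: by end_near. Qed.

Variables (c : chart R n M) (cM : atlas M c) (p : M) (cp : cdom c p).

Lemma tangent_tmapK :
  cancel (tmap (tangent_triv cM) p) (tinv (tangent_triv cM) p).
Proof.
move=> v /=; apply: Jacobian_inv => //.
- exact: chart_at_atlas.
- exact: chart_at_dom.
Qed.

Lemma tangent_tinvK :
  cancel (tinv (tangent_triv cM) p) (tmap (tangent_triv cM) p).
Proof.
move=> v /=; apply: Jacobian_inv => //.
- exact: chart_at_atlas.
- exact: chart_at_dom.
Qed.

End Jacobians.

(** * Bump functions *)

Section Bump.
Variables (R : realType) (n : nat) (M : manifold R n).

(** In a chart, the bump is [flat 0] of a squared radius minus the squared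
    distance to the point. Its extension by zero is smooth because it vanishes
    off a compact set, which is closed in a Hausdorff manifold. *)
Lemma bump_exists (W : set M) p : open W -> W p ->
  exists b : M -> R, [/\ msmooth setT b, forall q, 0 <= b q, 0 < b p &
    exists K : set M, [/\ closed K, K `<=` W & forall q, ~ K q -> b q = 0]].
Proof.
move=> oW Wp; have [c cM cp] := atlas_cover p.
have cc := atlas_chart cM; have [oD _ cK _ ci] := cc.
have oV := open_chart_image cc oW.
have Vx : (c @` (cdom c `&` W)) (c p) by exists p.
have [r /= r0 rV] : exists2 r : R, 0 < r & ball (c p) r `<=` c @` (cdom c `&` W).
  by have /nbhs_ballP [r r0 rV] := open_nbhs_nbhs (conj oV Vx); exists r.
(* half the radius, so that the closed cube of radius e stays in the image *)
pose e := r / 2; have e0 : 0 < e by rewrite divr_gt0.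
have er : e < r by rewrite /e; lra.
pose K0 : set 'rV[R]_n :=
  [set v | forall j, `[c p 0 j - e, c p 0 j + e]%classic (v 0 j)].
have K0V : K0 `<=` c @` (cdom c `&` W).
  move=> v K0v; apply: rV; split=> // i j; rewrite (ord1 i) /ball /= ltr_distlC.
  by have := K0v j; rewrite /= in_itv /= => /andP[? ?]; apply/andP; split; lra.
have compact_K0 : compact K0.
  apply: (@rV_compact R n (fun j => `[c p 0 j - e, c p 0 j + e]%classic)) => j.
  exact: segment_compact.
pose K := cinv c @` K0.
have closed_K : closed K.
  apply: compact_closed; first exact: mhausdorff.
  apply: continuous_compact compact_K0; apply: continuous_in_subspaceT => v.
  rewrite inE => /K0V [q [Dq _] <-]; apply: ci; rewrite inE.
  by exists q.
have KW : K `<=` cdom c `&` W.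
  by move=> _ [v /K0V [q [Dq Wq] <-] <-]; rewrite cK ?inE.
pose g q := e ^+ 2 - \sum_j (c q 0 j - c p 0 j) ^+ 2.
pose b q := if q \in cdom c `&` W then flat 0 (g q) else 0.
have bK q : ~ K q -> b q = 0.
  move=> nKq; rewrite /b; case: ifPn => //; rewrite inE => -[Dq Wq].
  rewrite /flat; case: ifPn => // gq; exfalso; apply: nKq.
  exists (c q); last by rewrite cK ?inE.
  move=> j /=; rewrite in_itv /=.
  have : (c q 0 j - c p 0 j) ^+ 2 < e ^+ 2.
    apply: le_lt_trans (_ : \sum_j (c q 0 j - c p 0 j) ^+ 2 < _); last first.
      by rewrite -subr_gt0.
    rewrite (bigD1 j) //= lerDl; apply: sumr_ge0 => i _; exact: sqr_ge0.
  rewrite -(real_normK (num_real (c q 0 j - _))) ltr_pXn2r ?nnegrE ?(ltW e0) //.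
  by rewrite ltr_norml => /andP[? ?]; apply/andP; split; lra.
exists b; split.
- apply: msmooth_local => q _; have [DWq|DWq] := pselect ((cdom c `&` W) q).
    have oDW := openI oD oW; exists (cdom c `&` W) => //.
    apply: (msmooth_ext (f := fun q => flat 0 (g q))) => //.
      by move=> x DWx; rewrite /b ifT // inE.
    apply: msmooth_flat => //; apply: msmoothB => //; first exact: msmooth_cst.
    apply: msmooth_sum => // j _.
    have h : msmooth (cdom c `&` W) (fun q => c q 0 j - c p 0 j).
      apply: msmoothB => //; last exact: msmooth_cst.
      by apply: msmoothS (chart_coord_smooth cM j) => x [].
    exact: msmoothM.
  exists (~` K); first by move=> /KW.
  apply: (msmooth_ext (f := fun=> 0)); first exact: closed_openC.
    by move=> x /bK.
  exact: msmooth_cst.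
- by move=> q; rewrite /b; case: ifP => // _; exact: flat_ge0.
- rewrite /b ifT ?inE // flat_gt0 /g big1 ?subr0 ?exprn_gt0 // => j _.
  by rewrite subrr expr0n.
- by exists K; split=> // q /KW [].
Qed.
End Bump.

(** * Locally finite weights *)

Section Weights.
Variables (R : realType) (n : nat) (M : manifold R n).
Variable good : set M -> Prop.
Hypotheses (good0 : good set0)
  (good_cover : forall p, exists U, [/\ open U, U p & good U]).

(** Here [good] is meant to single out open sets on which some problem is
    solvable; it holds of the empty set so that sequences of bumps may be padded
    with the zero function. *)
Definition good_bump (b : M -> R) : Prop :=
  [/\ msmooth setT b, forall q, 0 <= b q & exists K U : set M,
    [/\ closed K, open U, K `<=` U, good U & forall q, ~ K q -> b q = 0]].

(** Each basic open set on which some good bump is positive contributes one such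
    bump; a countable basis thus leaves countably many bumps. *)
Lemma good_bump_cover :
  exists b : nat -> M -> R, (forall i, good_bump (b i)) /\
    forall q, exists i, 0 < b i q.
Proof.
have [B /countable_injP [f fI] [_ Bq]] := @msecond_countable _ _ M.
pose P i := [set b | good_bump b /\
  exists V, [/\ B V, f V = i & forall q, V q -> 0 < b q]].
exists (fun i => xget (fun=> 0) (P i)); split=> [i|q].
  case: xgetP => [b _ []//|_]; split=> [|//|]; first exact: msmooth_cst.
  by exists set0, set0; split=> //; [exact: closed0|exact: open0].
have [U [oU Uq gU]] := good_cover q.
have [b [sb b0 bq [K [cK KU bK]]]] := bump_exists oU Uq.
have gb : good_bump b by split=> //; exists K, U.
have : nbhs q [set x | 0 < b x].
  have cb : {for q, continuous _} := msmooth_continuous openT (I : setT q) sb.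
  exact: (cb _ (lt_nbhsr bq)).
move=> /(Bq q) [V [BV Vq] Vb].
have Pb : P (f V) b by split=> //; exists V; split.
exists (f V); case: xgetP => [b' _ [_ [V' [BV' fV' V'b]]]|/(_ b)//].
by apply: V'b; rewrite (fI V' V) ?inE.
Qed.

(** The factors of the weight with index i vanish wherever one of the earlier
    bumps exceeds 1 / (i + 1): this makes the family locally finite on any
    manifold with a countable basis. *)
Lemma weights_exist :
  exists phi : nat -> M -> R, [/\ forall i, good_bump (phi i),
    forall q, exists i, 0 < phi i q &
    forall q, exists N W, [/\ open W, W q &
      forall x i, W x -> (N <= i)%N -> phi i x = 0]].
Proof.
have [b [gb bq]] := good_bump_cover.
pose phi i q := b i q * \prod_(j < i) flat 0 (i.+1%:R^-1 - b j q).
exists phi; split=> [i|q|q].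
- have [sb b0 [K [U [cK oU KU gU bK]]]] := gb i; split.
  + apply: msmoothM => //; first exact: openT.
    apply: msmooth_prod => [|j _]; first exact: openT.
    apply: msmooth_flat; first exact: openT.
    by apply: msmoothB; [exact: openT|exact: msmooth_cst|have [] := gb j].
  + by move=> q; rewrite mulr_ge0 // prodr_ge0 // => j _; exact: flat_ge0.
  + by exists K, U; split=> // q /bK; rewrite /phi => ->; rewrite mul0r.
(* at the first bump that is positive at q, no factor vanishes *)
- have [i bi mini] := ex_minnP (bq q).
  exists i; rewrite mulr_gt0 // prodr_gt0 // => j _.
  have /eqP -> : b j q == 0.
    have [_ b0 _] := gb j; rewrite eq_le b0 andbT leNgt.
    by apply/negP => /mini; rewrite leqNgt ltn_ord.
  by rewrite flat_gt0 subr0 invr_gt0.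
- have [j bj] := bq q; have [sb _ _] := gb j.
  have [m _ /(_ m (leqnn m)) /= mb] := near_infty_natSinv_lt (PosNum bj).
  pose N := maxn j.+1 m; exists N, [set x | m.+1%:R^-1 < b j x]; split=> //.
    rewrite openE => x /= xb.
    have cb : {for x, continuous _} := msmooth_continuous openT (I : setT x) sb.
    exact: (cb _ (lt_nbhsr xb)).
  move=> x i /= xb; rewrite geq_max => /andP[ji mi].
  rewrite /phi (bigD1 (Ordinal ji)) //= [flat 0 _](_ : _ = 0) ?mul0r ?mulr0 //.
  apply/eqP; rewrite eq_le flat_ge0 andbT leNgt flat_gt0 -leNgt subr_le0.
  apply: le_trans (ltW xb).
  by rewrite lef_pV2 ?posrE ?ltr0n // ler_nat ltnS.
Qed.

End Weights.

(** * Sections of vector bundles *)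

Lemma sum_nat_tail (V : nmodType) (F : nat -> V) a b :
  (forall i, (a <= i)%N -> F i = 0) -> (forall i, (b <= i)%N -> F i = 0) ->
  \sum_(0 <= i < a) F i = \sum_(0 <= i < b) F i.
Proof.
wlog ab : a b / (a <= b)%N => [wl|] aF bF.
  by have [/wl|/ltnW /wl] := leqP a b; [exact|move=> <-].
rewrite [RHS](big_cat_nat (leq0n a) ab) /= [X in _ = _ + X]big_nat_cond.
rewrite [X in _ = _ + X]big1 ?addr0 // => i /andP[/andP[ai _] _].
exact: aF.
Qed.

Lemma linear_delta (R : nzRingType) (V : lmodType R) k (f : 'rV[R]_k -> V) :
  linear f -> forall y, f y = \sum_j y 0 j *: f (delta_mx 0 j).
Proof.
move=> lf y; pose fL := GRing.isLinear.Build R _ _ _ f lf.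
pose g : {linear 'rV[R]_k -> V} := HB.pack f fL.
rewrite -[LHS]/(g y) {1}(row_sum_delta y) linear_sum.
by apply: eq_bigr => j _; rewrite linearZ.
Qed.

Section Sections.
Variables (R : realType) (n : nat) (M : manifold R n).
Implicit Types (E : bundle_data M) (U W : set M).

Lemma smooth_on_local E U (s : forall p, E p) :
  (forall p, U p -> exists2 W, W p & smooth_on W s) -> smooth_on U s.
Proof.
move=> UP t tE j; apply: msmooth_local => p [/UP [W Wp ss] tp].
by exists (W `&` tdom t) => //; exact: ss.
Qed.

Lemma smooth_onS E U W (s : forall p, E p) : U `<=` W ->
  smooth_on W s -> smooth_on U s.
Proof.
by move=> UW ss t tE j; apply: msmoothS (ss t tE j) => p [/UW].
Qed.

Lemma smooth_on_ext E U (s s' : forall p, E p) : open U ->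
  (forall p, U p -> s p = s' p) -> smooth_on U s -> smooth_on U s'.
Proof.
move=> oU ss' ss t tE j; apply: msmooth_ext (ss t tE j).
  exact/openI/tdom_open.
by move=> p [Up _]; rewrite ss'.
Qed.

Lemma smooth_on_sum E U I (r : seq I) (s : I -> forall p, E p) : open U ->
  (forall i, smooth_on U (s i)) -> smooth_on U (fun p => \sum_(i <- r) s i p).
Proof.
move=> oU ss; elim: r => [|i r IH].
  by apply: smooth_on_ext (smooth_on0 U) => // p _; rewrite big_nil.
by apply: smooth_on_ext (smooth_onD oU (ss i) IH) => // p _; rewrite big_cons.
Qed.

(** Extension by zero; the values of [s] outside [U] are arbitrary. *)
Lemma smooth_onM0 E U K (f : M -> R) (s : forall p, E p) : open U -> closed K ->
  K `<=` U -> msmooth setT f -> (forall p, ~ K p -> f p = 0) ->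
  smooth_on U s -> smooth_on setT (fun p => f p *: s p).
Proof.
move=> oU cK KU sf fK ss; apply: smooth_on_local => p _.
have [Kp|Kp] := pselect (K p).
  exists U; first exact: KU.
  by apply: smooth_onM => //; exact: msmoothS sf.
exists (~` K) => //; have oK := closed_openC cK.
apply: smooth_on_ext (smooth_on0 _) => // q /fK ->.
by rewrite scale0r.
Qed.

Section Trivialization.
Variables (E : bundle_data M) (vE : vector_bundle E).

Lemma tinv_linear t p : trivs E t -> tdom t p -> linear (tinv t p).
Proof.
move=> tE tp a u v; have [tK iK] := vb_tmapK vE tE tp.
by apply: (can_inj tK); rewrite iK linearP !iK.
Qed.

(** Changes of trivializations are known to be smooth on constant vectors only;
    linearity extends this to vectors with smooth coordinates. *)
Lemma smooth_tinv t U (y : M -> 'rV[R]_(trank t)) : trivs E t -> open U ->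
  U `<=` tdom t -> (forall j, msmooth U (fun p => y p 0 j)) ->
  smooth_on U (fun p => tinv t p (y p)).
Proof.
move=> tE oU Ut sy t' t'E k; have oUt := openI oU (tdom_open t').
apply: (msmooth_ext (f := fun p =>
  \sum_j y p 0 j * tmap t' p (tinv t p (delta_mx 0 j)) 0 k)) => //.
  move=> p [/Ut tp _]; rewrite [in RHS](linear_delta (tinv_linear tE tp)).
  by rewrite linear_sum summxE; apply: eq_bigr => j _; rewrite linearZ mxE.
apply: msmooth_sum => // j _; apply: msmoothM => //.
  by apply: msmoothS (sy j) => p [].
by apply: msmoothS (vb_compat vE tE t'E (delta_mx 0 j) k) => p [/Ut].
Qed.

(** This lets pointwise identities be tested against arbitrary vectors of a
    fibre, while the axioms only speak of global sections. *)
Lemma Gamma_through p (v : E p) : exists s : Gamma E, s p = v.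
Proof.
have [t tE tp] := vb_cover vE p; have oD := tdom_open t.
have [b [sb _ bp [K [cK Kt bK]]]] := bump_exists oD tp.
have ss : smooth_on (tdom t) (fun q => tinv t q ((b p)^-1 *: tmap t p v)).
  by apply: smooth_tinv => // j; exact: msmooth_cst.
exists (GammaOf (smooth_onM0 oD cK Kt sb bK ss)) => /=.
rewrite (GRing.scalable_linear (tinv_linear tE tp)).
have [-> _] := vb_tmapK vE tE tp.
by rewrite scalerA divff ?scale1r // gt_eqF.
Qed.

End Trivialization.

(** The solutions of a linear equation form an affine space, so local solutions
    may be averaged: the global one is the weighted mean of the [r i], whose
    numerator and denominator are locally finite sums. *)
Lemma global_solution E (V : M -> lmodType R) (l : forall p, {linear E p -> V p})
    (s : forall p, V p) :
  (forall p, exists U (r : forall p, E p),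
    [/\ open U, U p, smooth_on U r & forall q, U q -> l q (r q) = s q]) ->
  exists r : Gamma E, forall p, l p (r p) = s p.
Proof.
move=> locl.
pose good U := exists2 r : forall p, E p,
  smooth_on U r & forall q, U q -> l q (r q) = s q.
have good0 : good set0.
  by exists (fun=> 0) => //; exact: smooth_on0.
have goodU p : exists U, [/\ open U, U p & good U].
  by have [U [r [oU Up sr lr]]] := locl p; exists U; split=> //; exists r.
have [phi [gphi phi_pos phi_fin]] := weights_exist good0 goodU.
have /choice [r rP] i : exists r : forall p, E p,
    smooth_on setT (fun p => phi i p *: r p) /\
    forall q, phi i q *: l q (r q) = phi i q *: s q.
  have [sphi _ [K [U [cK oU KU [r sr lr] phiK]]]] := gphi i.
  exists r; split; first exact: smooth_onM0 cK KU sphi phiK sr.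
  move=> q; have [/KU Uq|/phiK ->] := pselect (K q); first by rewrite lr.
  by rewrite !scale0r.
(* beyond the index N q all weights vanish near q *)
have /choice [N NP] q : exists N, exists W, [/\ open W, W q &
  forall x i, W x -> (N <= i)%N -> phi i x = 0] by [].
pose den m q := \sum_(0 <= i < m) phi i q.
pose num m q := \sum_(0 <= i < m) phi i q *: r i q.
have sumN (V' : lmodType R) m (F : nat -> V') q :
    (forall i, (m <= i)%N -> phi i q = 0) ->
    \sum_(0 <= i < N q) phi i q *: F i = \sum_(0 <= i < m) phi i q *: F i.
  move=> phim; have [W [_ Wq phiN]] := NP q.
  apply: sum_nat_tail => i mi; first by rewrite phiN ?scale0r.
  by rewrite phim ?scale0r.
have den0 q : den (N q) q != 0.
  have [W [_ Wq phiN]] := NP q; have [i phii] := phi_pos q.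
  have iN : (i < N q)%N.
    rewrite ltnNge; apply/negP => /(phiN _ _ Wq) phi0.
    by rewrite phi0 ltxx in phii.
  rewrite gt_eqF // /den big_mkord (bigD1 (Ordinal iN)) //=.
  apply: ltr_wpDr => //; apply: sumr_ge0 => k _.
  by have [_ + _] := gphi k; apply.
pose sigma q := (den (N q) q)^-1 *: num (N q) q.
have ss : smooth_on setT sigma.
  apply: smooth_on_local => q _; have [W [oW Wq phiN]] := NP q.
  have eden x : W x -> den (N x) x = den (N q) x.
    move=> Wx; have := sumN R^o (N q) (fun=> 1) x (fun i => phiN x i Wx).
    by rewrite /den; under eq_bigr do rewrite /GRing.scale /= mulr1;
      under [RHS]eq_bigr do rewrite /GRing.scale /= mulr1.
  exists W => //.
  apply: (smooth_on_ext (s := fun x => (den (N q) x)^-1 *: num (N q) x)) => //.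
    move=> x Wx; rewrite /sigma eden // /num (sumN _ (N q)) // => i.
    exact: phiN.
  apply: smooth_onM => //.
    apply: msmoothV => //; first by move=> x Wx; rewrite -eden.
    apply: msmooth_sum => // i _; have [sphi _ _] := gphi i.
    exact: msmoothS sphi.
  apply: smooth_on_sum => // i; have [sri _] := rP i.
  exact: smooth_onS sri.
exists (GammaOf ss) => q /=.
rewrite /sigma linearZ linear_sum /=.
rewrite (eq_bigr (fun i => phi i q *: s q)); last first.
  by move=> i _; rewrite linearZ /=; have [_ ->] := rP i.
by rewrite -scaler_suml scalerA mulVf // scale1r.
Qed.

End Sections.

(** * Smooth right inverses *)

Section RightInverse.
Variables (R : realType) (n : nat) (M : manifold R n).
Implicit Types (U W : set M).

Lemma msmooth_det U k (A : M -> 'M[R]_k) : open U ->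
  (forall i j, msmooth U (fun p => A p i j)) -> msmooth U (fun p => \det (A p)).
Proof.
move=> oU sA; apply: msmooth_sum => // s _; apply: msmoothM => //.
  exact: msmooth_cst.
by apply: msmooth_prod => // i _; exact: sA.
Qed.

Lemma msmooth_mulmx U k l m (A : M -> 'M[R]_(k, l)) (B : M -> 'M[R]_(l, m)) :
  open U -> (forall i j, msmooth U (fun p => A p i j)) ->
  (forall i j, msmooth U (fun p => B p i j)) ->
  forall i j, msmooth U (fun p => (A p *m B p) i j).
Proof.
move=> oU sA sB i j.
apply: (msmooth_ext (f := fun p => \sum_l A p i l * B p l j)) => //.
  by move=> p _; rewrite mxE.
by apply: msmooth_sum => // a _; apply: msmoothM => //.
Qed.

Lemma msmooth_invmx U k (A : M -> 'M[R]_k) : open U ->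
  (forall p, U p -> \det (A p) != 0) ->
  (forall i j, msmooth U (fun p => A p i j)) ->
  forall i j, msmooth U (fun p => invmx (A p) i j).
Proof.
move=> oU A0 sA i j.
apply: (msmooth_ext (f := fun p => (\det (A p))^-1 *
  ((-1) ^+ (j + i) * \det (row' j (col' i (A p)))))) => //.
  move=> p Up; rewrite /invmx ifT; last by rewrite unitmxE unitfE A0.
  by rewrite mxE [in RHS]mxE.
apply: msmoothM => //; first by apply: msmoothV => //; exact: msmooth_det.
apply: msmoothM => //; first exact: msmooth_cst.
apply: msmooth_det => // a b; apply: msmooth_ext (sA (lift j a) (lift i b)) => //.
by move=> p _; rewrite !mxE.
Qed.

Section TrivMatrix.
Variables (E : bundle_data M) (vE : vector_bundle E).
Variables (t : local_triv E) (p : M) (tE : trivs E t) (tp : tdom t p).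
Variables (k : nat) (f : E p -> 'rV[R]_k) (lf : linear f).

Definition triv_mx := \matrix_i f (tinv t p (delta_mx 0 i)).

Lemma triv_mxE x : f x = tmap t p x *m triv_mx.
Proof.
have lft : linear (f \o tinv t p).
  by move=> a u v /=; rewrite (tinv_linear vE tE tp) lf.
have [tK _] := vb_tmapK vE tE tp.
rewrite -{1}(tK x) -[LHS]/((f \o tinv t p) _) (linear_delta lft).
apply/rowP => j; rewrite summxE !mxE.
by apply: eq_bigr => i _; rewrite !mxE.
Qed.

Lemma triv_mx_right_inverse : (forall w, exists x, f x = w) ->
  exists B, B *m triv_mx = 1%:M.
Proof.
move=> surj_f; have /choice [x xP] j := surj_f (delta_mx 0 j).
exists (\matrix_j tmap t p (x j)).
by apply/row_matrixP => j; rewrite row_mul rowK row1 -triv_mxE.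
Qed.

End TrivMatrix.

(** A smooth family of linear maps that is onto at one point has a smooth right
    inverse near that point: if [B *m A] is the identity matrix there, then
    [B *m A] stays invertible nearby, and [B] followed by its inverse will do. *)
Lemma local_right_inverse (E : bundle_data M) k W p0
    (f : forall p, E p -> 'rV[R]_k) : vector_bundle E -> open W -> W p0 ->
  (forall p, W p -> linear (f p)) ->
  (forall U (s : forall p, E p), open U -> smooth_on U s ->
    forall j, msmooth (U `&` W) (fun p => f p (s p) 0 j)) ->
  (forall w, exists x, f p0 x = w) ->
  exists W' (g : forall p, 'rV[R]_k -> E p),
    [/\ open W', W' p0, W' `<=` W, forall p w, W' p -> f p (g p w) = w &
      forall U (y : M -> 'rV[R]_k), open U ->
      (forall j, msmooth U (fun p => y p 0 j)) ->
      smooth_on (U `&` W') (fun p => g p (y p))].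
Proof.
move=> vE oW Wp0 lf sf surj_f; have [t tE tp0] := vb_cover vE p0.
have oD := tdom_open t; have oDW := openI oD oW.
pose A p := triv_mx t (f p).
have sA i j : msmooth (tdom t `&` W) (fun p => A p i j).
  have sd : smooth_on (tdom t) (fun p => tinv t p (delta_mx 0 i)).
    by apply: (smooth_tinv vE) => // l; exact: msmooth_cst.
  by apply: msmooth_ext (sf _ _ oD sd j) => // p _; rewrite mxE.
have [B BA] := triv_mx_right_inverse vE tE tp0 (lf p0 Wp0) surj_f.
have sBA U i j : open U -> U `<=` tdom t `&` W ->
    msmooth U (fun p => (B *m A p) i j).
  move=> oU UD; apply: msmooth_mulmx => // a b; first exact: msmooth_cst.
  exact: msmoothS (sA a b).
pose W' := tdom t `&` W `&` [set p | \det (B *m A p) != 0].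
have oW' : open W'.
  rewrite openE => p [DWp /= dp]; apply: filterI; first exact: open_nbhs_nbhs.
  have sdet : msmooth (tdom t `&` W) (fun p => \det (B *m A p)).
    by apply: msmooth_det => // i j; exact: sBA.
  have cdet : {for p, continuous _} := msmooth_continuous oDW DWp sdet.
  apply: (cdet [set y | y != 0]).
  exact: open_nbhs_nbhs (conj (@open_neq _ _) dp).
exists W', (fun p w => tinv t p (w *m invmx (B *m A p) *m B)); split=> //.
- by split=> //=; rewrite [B *m _]BA det1 oner_neq0.
- by move=> p [[]].
- move=> p w [[tp Wp] /= dp]; rewrite (triv_mxE vE tE tp (lf p Wp)).
  have [_ ->] := vb_tmapK vE tE tp; rewrite -!mulmxA mulVmx ?mulmx1 //.
  by rewrite unitmxE unitfE.
- move=> U y oU sy; have oUW := openI oU oW'.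
  apply: (smooth_tinv vE) => //; first by move=> p [_ [[]]].
  move=> j; apply: msmooth_mulmx => // [i a|a b]; last exact: msmooth_cst.
  apply: msmooth_mulmx => // [i' a'|a' b].
    by rewrite (ord1 i'); apply: msmoothS (sy a') => p [].
  apply: msmooth_invmx => // [p [_ []]//|c e].
  by apply: sBA => // p [_ []].
Qed.

End RightInverse.

(** * Quotient bundles *)

Section QuotientBundles.
Variables (R : realType) (n : nat) (M : manifold R n).
Variables (E : bundle_data M) (K : forall p, set (E p)).
Arguments K p _ : clear implicits.
Hypothesis vE : vector_bundle E.

(** In a trivialization of the quotient, the projection becomes a smooth family
    of surjective linear maps. The hypothesis on [s] involves a single
    trivialization, so that the lemma also serves to compare two of them. *)
Lemma quot_local_lift (t : local_triv (quot_fiber K)) U p0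
    (s : forall p, quot_fiber K p) : quot_trivs t ->
  open U -> U p0 -> tdom t p0 ->
  (forall j, msmooth (U `&` tdom t) (fun p => tmap t p (s p) 0 j)) ->
  exists W (r : forall p, E p), [/\ open W, W p0, W `<=` U `&` tdom t,
    smooth_on W r & forall q, W q -> qpi (K q) (r q) = s q].
Proof.
move=> [tK tS] oU Up0 tp0 ss; have oD := tdom_open t; have oUD := openI oU oD.
have [||p tp a u v|V r oV sr j|w|W [g [oW Wp0 Wt fg sg]]] :=
    @local_right_inverse R n M E (trank t) (tdom t) p0
      (fun p m => tmap t p (qpi (K p) m)) vE.
- by [].
- by [].
- by rewrite !linearP.
- exact: tS.
- have [_ iK] := tK p0 tp0; exists (repr (tinv t p0 w)).
  by rewrite [qpi _ _]qpi_surj iK.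
exists (U `&` tdom t `&` W), (fun p => g p (tmap t p (s p))); split.
- exact: openI.
- by split.
- by move=> p [].
- exact: sg.
- move=> q [[_ tq] Wq]; have [tKq _] := tK q tq.
  by apply: (can_inj tKq); rewrite fg.
Qed.

Hypothesis quot_cover : forall p,
  exists2 t : local_triv (quot_fiber K), quot_trivs t & tdom t p.

(** A coordinate vector of one trivialization lifts locally to a smooth section
    of [E], whose class has smooth coordinates in the other one. *)
Lemma quot_vector_bundle : vector_bundle (quot_bundle K).
Proof.
split=> [//|t p [tK _] //|t t' tE t'E v j]; first exact: tK.
have oDD := openI (tdom_open t) (tdom_open t').
apply: msmooth_local => p [tp t'p].
have [tK _] := tE; have [_ t'S] := t'E.
have [j'|W [r [oW Wp WD sr rE]]] := quot_local_lift tE oDD (conj tp t'p) tp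
    (s := fun p => tinv t p v).
  apply: (msmooth_ext (f := fun=> v 0 j')); last exact: msmooth_cst.
    by apply: openI => //; exact: tdom_open.
  by move=> q [_ tq]; have [_ ->] := tK q tq.
exists W => //; have sr' := t'S W r oW sr j.
apply: (msmooth_ext oW _ (msmoothS _ sr')) => q Wq; first by rewrite rE.
by split=> //; have [[]] := WD q Wq.
Qed.

Lemma quot_section_lift (m : Gamma (quot_bundle K)) :
  exists mt : Gamma E, map_sec (quot_proj K) mt = m.
Proof.
have [p|mt mtP] := @global_solution R n M E (quot_fiber K)
    (fun p => qpi (K p)) m; last by exists mt; apply: Gamma_ext.
have [t tE tp] := quot_cover p.
have [j|W [r [oW Wp _ sr rE]]] := quot_local_lift tE openT I tp (s := m).
  exact: (GammaP m tE).
by exists W, r; split.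
Qed.

End QuotientBundles.

(** * The pairing of an exact CLWX 2-algebroid *)

Definition lin_of (R : nzRingType) (V W : lmodType R) (f : V -> W)
    (lf : linear f) : {linear V -> W} :=
  HB.pack f (GRing.isLinear.Build R V W *:%R f lf).

Lemma lspan_id (R : realType) (V : lmodType R) (K : set V) v :
  submod_closed (fun u => `[< K u >] : bool) -> reflect (K v) (v \in lspan K).
Proof.
move=> cK; apply: (iffP idP) => [/asboolP vK|Kv]; last first.
  by apply/asboolP => P; apply.
pose P : {pred V} := fun u => `[< K u >].
pose Q : submodClosed V := HB.pack P (GRing.isSubmodClosed.Build R V P cK).
have : v \in Q by apply: vK => x Kx; apply/asboolP.
by move=> /asboolP.
Qed.

Section Pairing.
Variables (R : realType) (n : nat) (M : manifold R n) (E1 E0 : bundle_data M).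
Variable S : forall p, E1 p * E0 p -> E1 p * E0 p -> R.
Arguments S p _ _ : clear implicits.
Hypotheses (vE1 : vector_bundle E1) (vE0 : vector_bundle E0).
Hypothesis fS : graded_form (fun=> setT) S.

Definition pairing p (x : E1 p) (e : E0 p) : R := S p (x, 0) (0, e).

(** The two summands are isotropic, so [S] amounts to the pairing of degree -1
    with degree 0. *)
Lemma form_pairing p (a b : E1 p * E0 p) :
  S p a b = pairing a.1 b.2 + pairing b.1 a.2.
Proof.
have DS (a' b' c' : E1 p * E0 p) : S p a' (b' + c') = S p a' b' + S p a' c'.
  by rewrite -[b' in LHS]scale1r (gf_linear fS) // mul1r.
have split_pair (a' : E1 p * E0 p) : a' = (a'.1, 0) + (0, a'.2).
  by case: a' => x e; congr (_, _); rewrite /= ?addr0 ?add0r.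
rewrite [a in LHS]split_pair [b in LHS]split_pair DS.
rewrite ![S p (_ + _) _](gf_sym fS) // !DS.
rewrite (gf_isotropic1 fS) (gf_isotropic0 fS) // add0r addr0 addrC.
by rewrite [S p (0, _) _](gf_sym fS).
Qed.

Lemma pairing_linearr p (x : E1 p) : linear (pairing x : E0 p -> R^o).
Proof.
move=> k e e'; rewrite /pairing /GRing.scale /= -(gf_linear fS) //.
by congr (S p _ _); congr (_, _); rewrite /= ?scaler0 ?addr0.
Qed.

Lemma pairing_linearl p (e : E0 p) :
  linear ((fun x => pairing x e) : E1 p -> R^o).
Proof.
move=> k x x'; rewrite /pairing ![S p _ (0, e)](gf_sym fS) //.
rewrite /GRing.scale /= -(gf_linear fS) //.
by congr (S p _ _); congr (_, _); rewrite /= ?scaler0 ?addr0.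
Qed.

Lemma pairing0r p (x : E1 p) : pairing x 0 = 0.
Proof. exact: (linear0 (lin_of (pairing_linearr x))). Qed.

Lemma pairing0l p (e : E0 p) : pairing 0 e = 0.
Proof. exact: (linear0 (lin_of (pairing_linearl e))). Qed.

Lemma pairingBl p (x y : E1 p) (e : E0 p) :
  pairing (x - y) e = pairing x e - pairing y e.
Proof. exact: (linearB (lin_of (pairing_linearl e))). Qed.

Lemma pairingBr p (x : E1 p) (e e' : E0 p) :
  pairing x (e - e') = pairing x e - pairing x e'.
Proof. exact: (linearB (lin_of (pairing_linearr x))). Qed.

Lemma pairingDr p (x : E1 p) (e e' : E0 p) :
  pairing x (e + e') = pairing x e + pairing x e'.
Proof. exact: (linearD (lin_of (pairing_linearr x))). Qed.

Lemma pairingZr p (x : E1 p) k (e : E0 p) :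
  pairing x (k *: e) = k * pairing x e.
Proof. exact: (GRing.scalable_linear (pairing_linearr x)). Qed.

Lemma pairing_eq0l p (x : E1 p) : (forall e : E0 p, pairing x e = 0) -> x = 0.
Proof.
move=> x0; suff [] : (x, 0 : E0 p) = 0 by [].
apply: (gf_nondeg fS) => // b _.
by rewrite form_pairing /= x0 pairing0r addr0.
Qed.

Lemma pairing_eq0r p (e : E0 p) : (forall x : E1 p, pairing x e = 0) -> e = 0.
Proof.
move=> e0; suff [] : (0 : E1 p, e) = 0 by [].
apply: (gf_nondeg fS) => // b _.
by rewrite form_pairing /= e0 pairing0l addr0.
Qed.

Lemma pairing_injl p (x y : E1 p) :
  (forall e : E0 p, pairing x e = pairing y e) -> x = y.
Proof.
move=> xy; apply/eqP; rewrite -subr_eq0; apply/eqP/pairing_eq0l => e.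
by rewrite pairingBl xy subrr.
Qed.

Lemma pairing_injr p (e e' : E0 p) :
  (forall x : E1 p, pairing x e = pairing x e') -> e = e'.
Proof.
move=> xy; apply/eqP; rewrite -subr_eq0; apply/eqP/pairing_eq0r => x.
by rewrite pairingBr xy subrr.
Qed.

Lemma pairing_smooth U (x : forall p, E1 p) (e : forall p, E0 p) : open U ->
  smooth_on U x -> smooth_on U e -> msmooth U (fun p => pairing (x p) (e p)).
Proof.
move=> oU sx se.
by apply: (gf_smooth fS oU (u := fun=> 0) (m' := fun=> 0)) => //; exact: smooth_on0.
Qed.

(** Nondegeneracy makes the columns of the Gram matrix in a pair of
    trivializations independent, so that its rows span all coordinate vectors of
    covectors. *)
Lemma pairing_dual p (phi : E0 p -> R^o) : linear phi ->
  exists x : E1 p, forall e, pairing x e = phi e.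
Proof.
move=> lphi; have [t1 t1E tp1] := vb_cover vE1 p.
have [t0 t0E tp0] := vb_cover vE0 p.
have l1 := tinv_linear vE1 t1E tp1; have l0 := tinv_linear vE0 t0E tp0.
have [K1 _] := vb_tmapK vE1 t1E tp1; have [K0 _] := vb_tmapK vE0 t0E tp0.
pose G := \matrix_(i, j)
  pairing (tinv t1 p (delta_mx 0 i)) (tinv t0 p (delta_mx 0 j)).
have GE v w : pairing (tinv t1 p v) (tinv t0 p w) = (v *m G *m w^T) 0 0.
  have lv : linear (fun v => pairing (tinv t1 p v) (tinv t0 p w) : R^o).
    by move=> a b c; rewrite l1 pairing_linearl.
  have lw i : linear (fun w => pairing (tinv t1 p (delta_mx 0 i)) (tinv t0 p w) : R^o).
    by move=> a b c; rewrite l0 pairing_linearr.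
  rewrite (linear_delta lv) -mulmxA mxE; apply: eq_bigr => i _.
  rewrite (linear_delta (lw i)) mxE; congr (_ * _); apply: eq_bigr => j _.
  by rewrite !mxE mulrC.
have fullG : row_full G.
  rewrite /row_full -mxrank_tr -[_ == _]/(row_free G^T).
  apply: inj_row_free => w wG.
  suff w0 : tinv t0 p w = 0.
    have [_ iK0] := vb_tmapK vE0 t0E tp0.
    by rewrite -(iK0 w) w0 linear0.
  apply: pairing_eq0r => x; rewrite -(K1 x) GE -mulmxA.
  by rewrite -(trmxK (G *m _)) trmx_mul trmxK wG trmx0 mulmx0 mxE.
have [B BG] := row_fullP fullG.
pose y := \row_j phi (tinv t0 p (delta_mx 0 j)).
exists (tinv t1 p (y *m B)) => e.
have lphit : linear (phi \o tinv t0 p).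
  by move=> a b c; rewrite /= l0 lphi.
rewrite -(K0 e) GE -(mulmxA y) BG mulmx1 mxE -[RHS]/((phi \o tinv t0 p) _).
rewrite (linear_delta lphit); apply: eq_bigr => j _.
by rewrite !mxE mulrC.
Qed.

End Pairing.

(** * The quotient by the image of the cotangent bundle *)

Section Exact.
Variables (R : realType) (n : nat) (M : manifold R n) (E1 E0 : bundle_data M).
Variables (d : bundle_map E1 E0) (rho : bundle_map E0 (tangent M)).
Variable S : forall p, E1 p * E0 p -> E1 p * E0 p -> R.
Variables (dia : graded_op (Gamma E1) (Gamma E0)) (Om : form3 E0 E1).
Hypothesis exact_dia : exact_clwx2_algebroid d rho S dia Om.

Local Notation clwx := (exact_clwx exact_dia).
Local Notation vE1 := (clwx_bundle1 clwx).
Local Notation vE0 := (clwx_bundle0 clwx).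
Local Notation fS := (clwx_form clwx).
Local Notation F := (ample_F rho S).
Local Notation pr := (ample_pr rho S).
Local Notation rs := (rho_star rho S).
Implicit Types p : M.

Lemma rho_d p (m : E1 p) : rho p (d p m) = 0.
Proof.
have : range (d p) (d p m) by exists m.
by rewrite (exact_E0 exact_dia).
Qed.

Lemma ker_rhoP p (e : E0 p) : rho p e = 0 -> exists m, d p m = e.
Proof.
move=> e0; have : [set e | rho p e = 0] e by [].
by rewrite -(exact_E0 exact_dia) => -[m _ <-]; exists m.
Qed.

Lemma rho_onto p v : exists e, rho p e = v.
Proof.
have : [set: tangent M p] v by [].
by rewrite -(exact_T exact_dia) => -[e _ <-]; exists e.
Qed.

(** [rho_star] is chosen among the solutions of this equation, which exist by
    duality. *)
Lemma rho_starE p (a : 'Hom('rV[R]_n, R^o)) (e : E0 p) :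
  pairing S (rs (a : cotangent M p)) e = a (rho p e).
Proof.
have [|x xa] := pairing_dual vE1 vE0 fS (p := p) (phi := fun e => a (rho p e)).
  by move=> k e1 e2; rewrite !linearP.
rewrite /pairing /rho_star; case: xgetP => [y _ yP|/(_ x) []]; first exact: yP.
exact: xa.
Qed.

Lemma rho_star_linear p : linear (fun a : cotangent M p => rs a).
Proof.
move=> k a b; apply: (pairing_injl fS) => e.
rewrite (pairing_linearl fS) !rho_starE.
by rewrite add_lfunE scale_lfunE.
Qed.

Lemma d_rho_star p (a : cotangent M p) : d p (rs a) = 0.
Proof.
have : range (@rho_star _ _ _ _ _ rho S p) (rs a) by exists a.
by rewrite (exact_E1 exact_dia).
Qed.

Lemma ker_dP p (m : E1 p) : d p m = 0 -> exists a : cotangent M p, rs a = m.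
Proof.
move=> m0; have : [set m | d p m = 0] m by [].
by rewrite -(exact_E1 exact_dia) => -[a _ <-]; exists a.
Qed.

(** The image of [rho_star] is the kernel of [d]; being a subspace, it is equal
    to the span in the definition of the quotient. *)
Lemma pr_eqP p (m m' : E1 p) : pr p m = pr p m' <-> d p m = d p m'.
Proof.
have cK : submod_closed
    (fun u => `[< range (@rho_star _ _ _ _ _ rho S p) u >] : bool).
  rewrite (exact_E1 exact_dia); split=> [|k u v]; rewrite !unfold_in.
    by apply/asboolP => /=; rewrite linear0.
  move=> /asboolP /= u0 /asboolP /= v0; apply/asboolP => /=.
  by rewrite linearP u0 v0 scaler0 addr0.
split=> [/qpiP/(lspan_id _ cK)|mm'].
  by rewrite (exact_E1 exact_dia) /= linearB => /eqP; rewrite subr_eq0 => /eqP.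
apply/qpiP/(lspan_id _ cK); rewrite (exact_E1 exact_dia) /= linearB mm' subrr.
by [].
Qed.

Lemma pr_surj p (x : F p) : exists m, pr p m = x.
Proof. by exists (repr x); exact: qpi_surj. Qed.

Definition ample_l1_fun p (x : F p) : E0 p := d p (xget 0 [set m | pr p m = x]).

Lemma ample_l1_funE p (m : E1 p) : ample_l1_fun (pr p m) = d p m.
Proof.
rewrite /ample_l1_fun; case: xgetP => [y _ /pr_eqP //|/(_ m) []].
by [].
Qed.

Lemma ample_l1_linear p : linear (@ample_l1_fun p).
Proof.
move=> k x y; have [u <-] := pr_surj x; have [v <-] := pr_surj y.
by rewrite -linearP !ample_l1_funE linearP.
Qed.

Lemma ample_l1_inj p : injective (@ample_l1_fun p).
Proof.
move=> x y; have [u <-] := pr_surj x; have [v <-] := pr_surj y.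
by rewrite !ample_l1_funE => /pr_eqP.
Qed.

Lemma rho_ample_l1 p (x : F p) : rho p (ample_l1_fun x) = 0.
Proof. exact: rho_d. Qed.

Lemma ample_l1_onto p (e : E0 p) : rho p e = 0 ->
  exists x, ample_l1_fun x = e.
Proof.
by move=> /ker_rhoP [m <-]; exists (pr p m); rewrite ample_l1_funE.
Qed.

(** The image of [ample_l1_fun] is the kernel of [rho], which has locally
    constant rank: near a point, [rho] extends by finitely many fixed linear
    forms [Q] to an isomorphism onto a fixed vector space, and these forms are
    then coordinates on the kernel. *)
Lemma ample_triv p0 : exists t : local_triv F,
  [/\ quot_trivs t, tdom t p0 &
    forall U (x : forall p, F p), open U ->
    smooth_on U (fun p => ample_l1_fun (x p)) ->
    forall j, msmooth (U `&` tdom t) (fun p => tmap t p (x p) 0 j)].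
Proof.
have [t0 t0E tp0] := vb_cover vE0 p0; have [c cM cp0] := atlas_cover p0.
have oD : open (cdom c `&` tdom t0).
  by apply: openI (tdom_open t0); have [] := atlas_chart cM.
have lRho : linear (fun e => tmap (tangent_triv cM) p0 (rho p0 e)).
  by move=> a u v; rewrite !linearP.
pose Rho := triv_mx t0 (fun e => tmap (tangent_triv cM) p0 (rho p0 e)).
pose K := row_base (kermx Rho); pose Q := pinvmx K.
pose l := \rank (kermx Rho).
pose h p e : 'rV[R]_(n + l) :=
  row_mx (tmap (tangent_triv cM) p (rho p e)) (tmap t0 p e *m Q).
have tangentE : trivs (tangent M) (tangent_triv cM) by exists c, cM.
have KRho : K *m Rho = 0.
  by apply/sub_kermxP; rewrite eq_row_base.
have KQ : K *m Q = 1%:M by rewrite mulmxVp // row_base_free.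
(* K spans the kernel of the anchor at p0 and Q is a left inverse of its
   inclusion, so h p0 is bijective *)
have RhoE e : tmap (tangent_triv cM) p0 (rho p0 e) = tmap t0 p0 e *m Rho.
  exact: (triv_mxE vE0 t0E tp0 lRho e).
have surj_rho w : exists e, tmap (tangent_triv cM) p0 (rho p0 e) = w.
  have [e re] := @rho_onto p0 (tinv (tangent_triv cM) p0 w).
  by exists e; rewrite re tangent_tinvK.
have [B BRho] := triv_mx_right_inverse vE0 t0E tp0 lRho surj_rho.
have rk_Rho : \rank Rho = n by apply/eqP/row_fullP; exists B.
have kE : trank t0 = (n + l)%N.
  have := rank_leq_row Rho; rewrite rk_Rho => nk.
  by rewrite /l mxrank_ker rk_Rho subnKC.
have lh p : linear (h p).
  move=> a u v; rewrite /h !linearP /= mulmxDl -scalemxAl.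
  by rewrite scale_row_mx add_row_mx.
have surj_h w : exists e, h p0 e = w.
  pose x0 := lsubmx w *m B.
  have [y yE] : exists y, x0 *m Q + y = rsubmx w.
    by exists (rsubmx w - x0 *m Q); rewrite addrC subrK.
  exists (tinv t0 p0 (x0 + y *m K)); rewrite /h RhoE.
  have [_ ->] := vb_tmapK vE0 t0E tp0.
  rewrite !mulmxDl -!(mulmxA y) KRho KQ mulmx0 mulmx1 addr0 yE.
  by rewrite -mulmxA BRho mulmx1 hsubmxK.
have sQ U (e : forall p, E0 p) : open U -> smooth_on U e ->
    forall j, msmooth (U `&` tdom t0) (fun p => (tmap t0 p (e p) *m Q) 0 j).
  move=> oU se; apply: msmooth_mulmx => [|i a|a b]; last exact: msmooth_cst.
    exact/openI/tdom_open.
  by rewrite (ord1 i); exact: se.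
have sh U (e : forall p, E0 p) : open U -> smooth_on U e ->
    forall j, msmooth (U `&` (cdom c `&` tdom t0)) (fun p => h p (e p) 0 j).
  move=> oU se j; have oUD := openI oU oD.
  rewrite -(splitK j); case: (fintype.split j) => i /=.
    apply: (msmooth_ext (f := fun p => tmap (tangent_triv cM) p (rho p (e p)) 0 i)) => //.
      by move=> p _; rewrite row_mxEl.
    apply: msmoothS (bfun_smooth rho oU se tangentE i) => p [Up [cp _]].
    by split.
  apply: (msmooth_ext (f := fun p => (tmap t0 p (e p) *m Q) 0 i)) => //.
    by move=> p _; rewrite row_mxEr.
  by apply: msmoothS (sQ U e oU se i) => p [Up [_ tp]].
have [W [g [oW Wp0 WD hg _]]] := local_right_inverse vE0 oD (conj cp0 tp0)
  (fun p _ => lh p) sh surj_h.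
(* on W the map h p is onto between spaces of the same dimension *)
have inj_h p : W p -> injective (h p).
  move=> Wp; have [_ tp] := WD p Wp.
  have [B' BH] : exists B', B' *m triv_mx t0 (h p) = 1%:M.
    apply: (triv_mx_right_inverse vE0 t0E tp (lh p)) => w.
    by exists (g p w); exact: hg.
  have free_H : row_free (triv_mx t0 (h p)).
    have /eqP rkH : row_full (triv_mx t0 (h p)) by apply/row_fullP; exists B'.
    by rewrite /row_free rkH -kE.
  move=> e e'; rewrite !(triv_mxE vE0 t0E tp (lh p)) => /(row_free_inj free_H).
  by have [tK _] := vb_tmapK vE0 t0E tp => /(can_inj tK).
pose tm p (x : F p) : 'rV[R]_l := tmap t0 p (ample_l1_fun x) *m Q.
have ltm p : linear (@tm p).
  by move=> a x y; rewrite /tm ample_l1_linear linearP mulmxDl -scalemxAl.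
pose ti p w : F p := xget 0 [set x | tm p x = w].
have tm_inj p : W p -> injective (@tm p).
  move=> Wp x y xy; apply: ample_l1_inj; apply: (inj_h p Wp).
  by rewrite /h !rho_ample_l1; congr row_mx.
have tiK p w : W p -> tm p (ti p w) = w.
  move=> Wp; rewrite /ti; case: xgetP => [x _ //|noX].
  have [cp tp] := WD p Wp.
  have hgw := hg p (row_mx 0 w) Wp.
  have [r0 gw] := eq_row_mx hgw.
  have {}r0 : rho p (g p (row_mx 0 w)) = 0.
    by apply: (can_inj (tangent_tmapK cM cp)); rewrite r0 linear0.
  have [x xg] := ample_l1_onto r0.
  by case: (noX x); rewrite /= /tm xg.
have UWS U : U `&` W `<=` U `&` tdom t0.
  by move=> q [Uq /WD [_ tq]].
exists (LocalTriv oW (fun p => lin_of (ltm p)) ti); split=> [|//|U x oU sx j].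
  split=> [p Wp|U s oU ss j].
    split=> x; last exact: tiK.
    by apply: (tm_inj p Wp); exact: tiK.
  have sds := msmoothS (@UWS U) (sQ _ _ oU (bfun_smooth d oU ss) j).
  apply: msmooth_ext (openI oU oW) _ sds => q _ /=.
  by rewrite /tm (ample_l1_funE (s q)).
exact: msmoothS (@UWS U) (sQ _ _ oU sx j).
Qed.

Lemma ample_cover p : exists2 t : local_triv F, quot_trivs t & tdom t p.
Proof. by have [t [tE tp _]] := ample_triv p; exists t. Qed.

Lemma ample_vector_bundle : vector_bundle F.
Proof. exact: quot_vector_bundle vE1 ample_cover. Qed.

Lemma ample_lift (m : Gamma F) : exists mt : Gamma E1, map_sec pr mt = m.
Proof. exact: quot_section_lift vE1 ample_cover m. Qed.

Lemma ample_local_lift U (x : forall p, F p) p : open U -> U p ->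
  smooth_on U x -> exists W (r : forall p, E1 p),
    [/\ open W, W p, W `<=` U, smooth_on W r & forall q, W q -> pr q (r q) = x q].
Proof.
move=> oU Up sx; have [t tE tp] := ample_cover p.
have [|W [r [oW Wp WU sr rE]]] := quot_local_lift vE1 tE oU Up tp (s := x).
  exact: sx.
by exists W, r; split=> // q /WU [].
Qed.

Lemma ample_l1_smooth U (x : forall p, F p) : open U -> smooth_on U x ->
  smooth_on U (fun p => ample_l1_fun (x p)).
Proof.
move=> oU sx; apply: smooth_on_local => p Up.
have [W [r [oW Wp WU sr rE]]] := ample_local_lift oU Up sx.
exists W => //; apply: (smooth_on_ext oW _ (bfun_smooth d oW sr)) => q Wq.
by rewrite -rE // ample_l1_funE.
Qed.

Definition ample_l1 : bundle_map F E0 :=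
  BundleMap (bfun := fun p => lin_of (@ample_l1_linear p)) ample_l1_smooth.

Lemma ample_l1E p (m : E1 p) : ample_l1 p (pr p m) = d p m.
Proof. exact: ample_l1_funE. Qed.

Lemma map_sec_l1E (m : Gamma E1) :
  map_sec ample_l1 (map_sec pr m) = map_sec d m.
Proof. by apply: Gamma_ext => p; exact: ample_l1E. Qed.

Lemma map_sec_l1_inj : injective (map_sec ample_l1).
Proof.
move=> x y /(congr1 (fun s : Gamma E0 => (fun p => s p))) xy; apply: Gamma_ext => p.
by apply: ample_l1_inj; exact: (congr1 (fun f => f p) xy).
Qed.

(** The section of [F] sent to [u] by the injection into [E0] is smooth since its
    coordinates are linear forms in [u]; it then lifts to [E1]. *)
Lemma ker_rho_lift (u : Gamma E0) : in_ker rho u ->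
  exists m : Gamma E1, map_sec d m = u.
Proof.
move=> u0; pose x p : F p := sval (cid (ample_l1_onto (u0 p))).
have xE p : ample_l1_fun (x p) = u p by rewrite /x; case: cid.
have [p|m mP] := @global_solution _ _ _ E1 _ (fun p => d p) u; last first.
  by exists m; apply: Gamma_ext.
have [t [tE tp tS]] := ample_triv p.
have sx : smooth_on setT (fun p => ample_l1_fun (x p)).
  by apply: smooth_on_ext (GammaP u) => [|q _]; [exact: openT|rewrite xE].
have [W [r [oW Wp _ sr rE]]] :=
  quot_local_lift vE1 tE openT (I : setT p) tp (tS setT x openT sx).
exists W, r; split=> // q Wq.
by rewrite -ample_l1_funE -xE; congr ample_l1_fun; exact: rE.
Qed.

(** In a local frame [e j] of [E0], the vector [rho_star a] is characterized by
    its pairings [a (rho (e j))], which are smooth; a smooth right inverse of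
    the family of these pairings recovers it. *)
Lemma rho_star_smooth U (a : forall p, cotangent M p) : open U ->
  smooth_on U a -> smooth_on U (fun p => rs (a p)).
Proof.
move=> oU sa; apply: smooth_on_local => p0 Up0.
have [t0 t0E tp0] := vb_cover vE0 p0; have [c cM cp0] := atlas_cover p0.
have oD := tdom_open t0; have oc := tdom_open (tangent_triv cM).
pose e (j : 'I_(trank t0)) p := tinv t0 p (delta_mx 0 j).
have se j : smooth_on (tdom t0) (e j).
  by apply: (smooth_tinv vE0) => // l; exact: msmooth_cst.
pose f p (m : E1 p) : 'rV[R]_(trank t0) := \row_j pairing S m (e j p).
have lf p : linear (f p).
  by move=> k m m'; apply/rowP => j; rewrite !mxE (pairing_linearl fS).
have f_inj p : tdom t0 p -> injective (f p).
  move=> tp m m' /rowP fmm'; apply: (pairing_injl fS) => v.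
  have [K0 _] := vb_tmapK vE0 t0E tp.
  have lm (x : E1 p) : linear (fun y => pairing S x (tinv t0 p y) : R^o).
    by move=> k y y'; rewrite (tinv_linear vE0 t0E tp) (pairing_linearr fS).
  rewrite -(K0 v) (linear_delta (lm m)) (linear_delta (lm m')).
  by apply: eq_bigr => j _; have := fmm' j; rewrite !mxE => ->.
have sf V (m : forall p, E1 p) : open V -> smooth_on V m ->
    forall j, msmooth (V `&` tdom t0) (fun p => f p (m p) 0 j).
  move=> oV sm j; have oVD := openI oV oD.
  apply: (msmooth_ext (f := fun p => pairing S (m p) (e j p))) => //.
    by move=> p _; rewrite mxE.
  apply: (pairing_smooth fS) => //.
    by apply: smooth_onS sm => p [].
  by apply: smooth_onS (se j) => p [].
have surj_f w : exists m, f p0 m = w.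
  have [|m mP] := pairing_dual vE1 vE0 fS (p := p0)
    (phi := fun v => \sum_j w 0 j * tmap t0 p0 v 0 j).
    move=> k u v; rewrite /GRing.scale /= mulr_sumr -big_split /=.
    by apply: eq_bigr => j _; rewrite linearP !mxE mulrDr mulrCA.
  exists m; apply/rowP => j; rewrite mxE mP.
  have [_ iK] := vb_tmapK vE0 t0E tp0.
  rewrite iK (bigD1 j) //= mxE !eqxx mulr1 big1 ?addr0 // => i ij.
  by rewrite mxE eqxx /= (negbTE ij) mulr0.
have [W [g [oW Wp0 WD fg sg]]] :=
  local_right_inverse vE1 oD tp0 (fun p _ => lf p) sf surj_f.
pose y p : 'rV[R]_(trank t0) :=
  \row_j (a p : 'Hom('rV[R]_n, R^o)) (rho p (e j p)).
have oUc : open (U `&` (cdom c `&` tdom t0)) by exact: openI oU (openI oc oD).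
exists (U `&` (cdom c `&` tdom t0) `&` W) => //.
have sy j : msmooth (U `&` (cdom c `&` tdom t0)) (fun p => y p 0 j).
  apply: (msmooth_ext (f := fun p => \sum_i
      tmap (tangent_triv cM) p (rho p (e j p)) 0 i *
      tmap (cotangent_triv cM) p (a p) 0 i)) => //.
    move=> p [_ [cp _]]; rewrite mxE -[in RHS](tangent_tmapK cM cp (rho p (e j p))).
    set v := tmap _ p _; pose ap : 'Hom('rV[R]_n, R^o) := a p.
    have la : linear (ap \o tinv (tangent_triv cM) p).
      by move=> k u u'; rewrite /= !linearP.
    rewrite -[RHS]/((ap \o tinv (tangent_triv cM) p) v) (linear_delta la).
    by apply: eq_bigr => i _; rewrite mxE.
  apply: msmooth_sum => // i _; apply: msmoothM => //.
    have tE : trivs (tangent M) (tangent_triv cM) by exists c, cM.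
    by apply: msmoothS (bfun_smooth rho oD (se j) tE i) => p [_ []].
  have tE : trivs (cotangent M) (cotangent_triv cM) by exists c, cM.
  by apply: msmoothS (sa _ tE i) => p [Up []].
apply: (smooth_on_ext _ _ (sg _ y oUc sy)); first exact: openI.
move=> p [_ Wp]; apply: (f_inj p (WD p Wp)); rewrite fg //.
by apply/rowP => j; rewrite !mxE rho_starE.
Qed.


(** * The ample Lie 2-algebroid *)

Definition rho_star_bmap : bundle_map (cotangent M) E1 :=
  BundleMap (bfun := fun p => lin_of (@rho_star_linear p)) rho_star_smooth.

Lemma map_sec_linear (A B : bundle_data M) (f : bundle_map A B) :
  linear (map_sec f).
Proof. by move=> k x y; apply: Gamma_ext => p; exact: linearP. Qed.

Lemma map_secD (A B : bundle_data M) (f : bundle_map A B) (x y : Gamma A) :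
  map_sec f (x + y) = map_sec f x + map_sec f y.
Proof. exact: (linearD (lin_of (map_sec_linear f))). Qed.

Lemma map_secB (A B : bundle_data M) (f : bundle_map A B) (x y : Gamma A) :
  map_sec f (x - y) = map_sec f x - map_sec f y.
Proof. exact: (linearB (lin_of (map_sec_linear f))). Qed.

Lemma map_secN (A B : bundle_data M) (f : bundle_map A B) (x : Gamma A) :
  map_sec f (- x) = - map_sec f x.
Proof. exact: (linearN (lin_of (map_sec_linear f))). Qed.

Lemma map_sec0 (A B : bundle_data M) (f : bundle_map A B) : map_sec f 0 = 0.
Proof. exact: (linear0 (lin_of (map_sec_linear f))). Qed.

Local Notation leib := (clwx_leibniz2 clwx).

Definition ample_l3 (x y z : Gamma E0) : Gamma F :=
  map_sec pr (form3_sec Om x y z).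

(** This is how the products, the only data given on sections rather than
    fibrewise, are seen to descend. *)
Lemma map_sec_pr_eq (m m' : Gamma E1) :
  map_sec d m = map_sec d m' -> map_sec pr m = map_sec pr m'.
Proof.
move=> dmm'; apply: map_sec_l1_inj.
by rewrite !map_sec_l1E.
Qed.

(** The class of a product does not depend on the lift of the class, since its
    image under [d] does not. *)
Lemma ample_l2_exists : {l2 : graded_op (Gamma F) (Gamma E0) |
  [/\ forall x y, op00 l2 x y = op00 dia x y,
      forall x m, op01 l2 x (map_sec pr m) = map_sec pr (op01 dia x m)
    & forall m x, op10 l2 (map_sec pr m) x = map_sec pr (op10 dia m x)]}.
Proof.
pose lift (m : Gamma F) : Gamma E1 := sval (cid (ample_lift m)).
have d_lift m : map_sec d (lift (map_sec pr m)) = map_sec d m.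
  by rewrite -!map_sec_l1E /lift; case: cid => mt /= ->.
exists (GradedOp (op00 dia) (fun x m => map_sec pr (op01 dia x (lift m)))
  (fun m x => map_sec pr (op10 dia (lift m) x))).
split=> //= [x m|m x]; apply: map_sec_pr_eq.
  by rewrite !(lb_a leib) d_lift.
by rewrite !(lb_b leib) d_lift.
Qed.

Definition ample_l2 := sval ample_l2_exists.

Lemma ample_op00E x y : op00 ample_l2 x y = op00 dia x y.
Proof. by rewrite /ample_l2; case: ample_l2_exists => l2 /= []. Qed.

Lemma ample_op01E x (m : Gamma E1) :
  op01 ample_l2 x (map_sec pr m) = map_sec pr (op01 dia x m).
Proof. by rewrite /ample_l2; case: ample_l2_exists => l2 /= []. Qed.

Lemma ample_op10E (m : Gamma E1) x :
  op10 ample_l2 (map_sec pr m) x = map_sec pr (op10 dia m x).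
Proof. by rewrite /ample_l2; case: ample_l2_exists => l2 /= []. Qed.

Lemma ample_leibniz2 : leibniz2_algebra (map_sec ample_l1) ample_l2 ample_l3.
Proof.
have E := (ample_op00E, ample_op01E, ample_op10E).
split.
- exact: map_sec_linear.
- by move=> y k x x'; rewrite !E (lb_00_linear1 leib).
- by move=> x k y y'; rewrite !E (lb_00_linear2 leib).
- move=> m k x y; have [mt <-] := ample_lift m.
  by rewrite !E (lb_01_linear1 leib) map_sec_linear.
- move=> x k m m'; have [mt <-] := ample_lift m.
  have [mt' <-] := ample_lift m'.
  by rewrite -map_sec_linear !E (lb_01_linear2 leib) map_sec_linear.
- move=> x k m m'; have [mt <-] := ample_lift m.
  have [mt' <-] := ample_lift m'.
  by rewrite -map_sec_linear !E (lb_10_linear1 leib) map_sec_linear.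
- move=> m k x y; have [mt <-] := ample_lift m.
  by rewrite !E (lb_10_linear2 leib) map_sec_linear.
- by move=> y z k x x'; rewrite /ample_l3 (lb_l3_linear1 leib) map_sec_linear.
- by move=> x z k y y'; rewrite /ample_l3 (lb_l3_linear2 leib) map_sec_linear.
- by move=> x y k z z'; rewrite /ample_l3 (lb_l3_linear3 leib) map_sec_linear.
- by move=> x m; have [mt <-] := ample_lift m; rewrite !E ?map_sec_l1E (lb_a leib).
- by move=> m x; have [mt <-] := ample_lift m; rewrite !E ?map_sec_l1E (lb_b leib).
- move=> m m'; have [mt <-] := ample_lift m.
  by have [mt' <-] := ample_lift m'; rewrite !map_sec_l1E !E (lb_c leib).
- by move=> x y z; rewrite !E /ample_l3 map_sec_l1E (lb_d leib).
- move=> x y m; have [mt <-] := ample_lift m.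
  by rewrite !E map_sec_l1E /ample_l3 (lb_e1 leib) !map_secB.
- move=> x m y; have [mt <-] := ample_lift m.
  by rewrite !E map_sec_l1E /ample_l3 (lb_e2 leib) !map_secB.
- move=> m x y; have [mt <-] := ample_lift m.
  by rewrite !E map_sec_l1E /ample_l3 (lb_e3 leib) !map_secB.
- move=> w x y z; rewrite /ample_l3 !E.
  have := congr1 (map_sec pr) (lb_f leib w x y z).
  by rewrite !(map_secB, map_secD) map_sec0.
Qed.

Lemma alternating_skew (V W : zmodType) (f : V -> V -> W) :
  (forall x y z, f (x + y) z = f x z + f y z) ->
  (forall x y z, f x (y + z) = f x y + f x z) ->
  (forall x, f x x = 0) -> forall x y, f x y = - f y x.
Proof.
move=> fl fr f0 x y; apply/eqP; rewrite -addr_eq0; apply/eqP.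
by have := f0 (x + y); rewrite fl !fr !f0 add0r addr0.
Qed.

Lemma ample_lie2 : lie2_algebra (map_sec ample_l1) ample_l2 ample_l3.
Proof.
split.
- exact: ample_leibniz2.
- by move=> x y; rewrite !ample_op00E; exact: (clwx_skew clwx).
- move=> x m; have [mt <-] := ample_lift m; apply: map_sec_l1_inj.
  rewrite map_secN ample_op01E ample_op10E !map_sec_l1E (lb_a leib) (lb_b leib).
  exact: (clwx_skew clwx).
- move=> x y z; apply: (alternating_skew (f := fun x y => ample_l3 x y z)).
  + by move=> u v w; rewrite -[u in LHS]scale1r (lb_l3_linear1 ample_leibniz2) scale1r.
  + by move=> u v w; rewrite -[v in LHS]scale1r (lb_l3_linear2 ample_leibniz2) scale1r.
  + move=> u; rewrite /ample_l3 -(map_sec0 pr); congr map_sec.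
    by apply: Gamma_ext => p; exact: form3_alt12.
- move=> x y z; apply: (alternating_skew (f := ample_l3 x)).
  + by move=> u v w; rewrite -[u in LHS]scale1r (lb_l3_linear2 ample_leibniz2) scale1r.
  + by move=> u v w; rewrite -[v in LHS]scale1r (lb_l3_linear3 ample_leibniz2) scale1r.
  + move=> u; rewrite /ample_l3 -(map_sec0 pr); congr map_sec.
    by apply: Gamma_ext => p; exact: form3_alt23.
Qed.

Lemma pairing_invariant (x y : Gamma E0) (m : Gamma E1) p :
  anchor_act rho x (fun q => pairing S (m q) (y q)) p =
  pairing S (op01 dia x m p) (y p) + pairing S (m p) (op00 dia x y p).
Proof.
have x0 : op00 dia x 0 = 0 := linear0 (lin_of (lb_00_linear2 leib x)).
have x1 : op01 dia x 0 = 0 := linear0 (lin_of (lb_01_linear2 leib x)).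
have o0 (z : Gamma E0) : op10 dia 0 z = 0 := linear0 (lin_of (lb_10_linear1 leib z)).
have := clwx_invariant clwx (0, x) (m, 0) (0, y).
move=> /(congr1 (fun f => f p)); rewrite /total_op /= x0 x1 !o0 !addr0.
by [].
Qed.

(** The Leibniz rule of the product in its second argument follows by
    duality from the invariance of the pairing. *)
Lemma dia_anchor (f : smoothfun M) (x y : Gamma E0) p :
  op00 dia x (fscale f y) p =
  f p *: op00 dia x y p + anchor_act rho x f p *: y p.
Proof.
apply: (pairing_injr fS) => m0; have [m <-] := Gamma_through vE1 m0.
have sP : msmooth setT (fun q => pairing S (m q) (y q)).
  by apply: (pairing_smooth fS); [exact: openT|exact: GammaP|exact: GammaP].
have := pairing_invariant x (fscale f y) m p.
have := pairing_invariant x y m p.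
rewrite (pairingDr fS) !(pairingZr fS) /anchor_act.
rewrite (_ : (fun q => pairing S (m q) (fscale f y q)) =
  fun q => f q * pairing S (m q) (y q)); last first.
  by rewrite funeqE => q; exact: (pairingZr fS).
rewrite (dirderM _ _ (smoothfunP f) sP) => -> /esym.
by rewrite mulrDr -addrA => /addrI.
Qed.

Lemma ample_lie2_algebroid :
  lie2_algebroid rho (map_sec ample_l1) ample_l2 ample_l3.
Proof.
split.
- exact: ample_vector_bundle.
- exact: vE0.
- exact: ample_lie2.
- by move=> f m; apply: Gamma_ext => p; exact: linearZ.
- move=> f x y z; apply: Gamma_ext => p; rewrite /= -linearZ; congr (pr p _).
  exact: (GRing.scalable_linear (form3_linear1 Om (y p) (z p))).
- move=> f x y z; apply: Gamma_ext => p; rewrite /= -linearZ; congr (pr p _).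
  exact: (GRing.scalable_linear (form3_linear2 Om (x p) (z p))).
- move=> f x y z; apply: Gamma_ext => p; rewrite /= -linearZ; congr (pr p _).
  exact: (GRing.scalable_linear (form3_linear3 Om (x p) (y p))).
- by move=> f x y p; rewrite !ample_op00E; exact: dia_anchor.
- move=> f x m p; have [mt <-] := ample_lift m; apply: (@ample_l1_inj p).
  have -> : fscale f (map_sec pr mt) = map_sec pr (fscale f mt).
    by apply: Gamma_ext => q; rewrite /= linearZ.
  have dZ : map_sec d (fscale f mt) = fscale f (map_sec d mt).
    by apply: Gamma_ext => q; rewrite /= linearZ.
  have l1E (m' : Gamma E1) : ample_l1 p (map_sec pr m' p) = map_sec d m' p.
    exact: ample_l1E.
  rewrite -[LHS]/(ample_l1 p _) -[RHS]/(ample_l1 p _) linearD !linearZ.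
  by rewrite !ample_op01E !l1E !(lb_a leib) dZ dia_anchor.
Qed.


(** ** The quadratic structure *)

(** A representative may be changed by the image of a covector, which pairs with
    [E0] through the anchor. *)
Lemma pairing_pr p (m m' : E1 p) (u : E0 p) : pr p m = pr p m' ->
  rho p u = 0 -> pairing S m u = pairing S m' u.
Proof.
move=> /pr_eqP dmm' u0; apply/eqP; rewrite -subr_eq0 -(pairingBl fS).
have [|a <-] := @ker_dP p (m - m'); first by rewrite linearB dmm' subrr.
by rewrite rho_starE u0 linear0.
Qed.

(** The form induced by [S], evaluated on chosen representatives; [pairing_pr]
    makes the choice immaterial on the kernel of the anchor. *)
Definition ample_form p (a b : F p * E0 p) : R :=
  pairing S (xget 0 [set m | pr p m = a.1]) b.2 +
  pairing S (xget 0 [set m | pr p m = b.1]) a.2.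

Lemma ample_formE p (m m' : E1 p) (u v : E0 p) : rho p u = 0 -> rho p v = 0 ->
  ample_form (pr p m, u) (pr p m', v) = pairing S m v + pairing S m' u.
Proof.
move=> u0 v0; have prX (x : E1 p) : pr p (xget 0 [set m | pr p m = pr p x]) = pr p x.
  by case: xgetP => [y _ //|/(_ x) []].
by rewrite /ample_form /= (pairing_pr (prX m) v0) (pairing_pr (prX m') u0).
Qed.

(** A vector of [E1 p] whose pairing with the kernel of the anchor vanishes
    pairs with [E0 p] through the anchor, hence is the image of a covector. *)
Lemma pairing_ker_eq0 p (m : E1 p) :
  (forall v, rho p v = 0 -> pairing S m v = 0) -> pr p m = 0.
Proof.
move=> m0; pose e (v : 'rV[R]_n) : E0 p := sval (cid (@rho_onto p v)).
have eE v : rho p (e v) = v by rewrite /e; case: cid.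
have mE v w : rho p v = rho p w -> pairing S m v = pairing S m w.
  move=> vw; apply/eqP; rewrite -subr_eq0 -(pairingBr fS) m0 //.
  by rewrite linearB vw subrr.
have le : linear (fun v => pairing S m (e v) : R^o).
  move=> k v w; rewrite -(pairing_linearr fS); apply: mE.
  by rewrite eE linearP !eE.
have -> : m = rs (linfun (lin_of le) : cotangent M p).
  apply: (pairing_injl fS) => v; rewrite rho_starE lfunE /=; apply: mE.
  by rewrite eE.
by rewrite -(linear0 (pr p)); apply/pr_eqP; rewrite d_rho_star linear0.
Qed.

Lemma ample_graded_form : graded_form (@ker_rho _ _ _ _ rho) ample_form.
Proof.
have pr0 p : 0 = pr p 0 by rewrite linear0.
split.
- move=> p k [x u] [y v] [z w] /= u0 v0 w0.
  have [m xm] := pr_surj x; have [m' ym] := pr_surj y; have [m'' zm] := pr_surj z.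
  have -> : k *: (y, v) + (z, w) = (pr p (k *: m' + m''), k *: v + w).
    by rewrite linearP ym zm.
  have vw0 : rho p (k *: v + w) = 0.
    by rewrite linearP [rho p v]v0 [rho p w]w0 scaler0 addr0.
  rewrite -xm -ym -zm !ample_formE //.
  rewrite (pairing_linearr fS) (pairing_linearl fS) /GRing.scale /=; ring.
- move=> p [x u] [y v] /= u0 v0.
  have [m <-] := pr_surj x; have [m' <-] := pr_surj y.
  by rewrite !ample_formE // addrC.
- move=> p [x u] /= u0 S0; have [m xm] := pr_surj x; rewrite -xm in S0 *.
  congr (_, _).
    apply: pairing_ker_eq0 => v v0; have := S0 (0, v) v0.
    by rewrite [X in ample_form _ (X, _)]pr0 ample_formE // (pairing0l fS) addr0.
  apply: (pairing_eq0r fS) => m'.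
  have := S0 (pr p m', 0) (linear0 (rho p)).
  by rewrite ample_formE ?linear0 // (pairing0r fS) add0r.
- move=> p x y; have [m <-] := pr_surj x; have [m' <-] := pr_surj y.
  by rewrite ample_formE ?linear0 // !(pairing0r fS) addr0.
- move=> p u v u0 v0; rewrite [X in (X, u)]pr0 [X in (X, v)]pr0.
  by rewrite ample_formE // !(pairing0l fS) addr0.
- move=> U x y u v oU sx sy su sv Uu Uv; apply: msmooth_local => p Up.
  have [W [r [oW Wp WU sr rE]]] := ample_local_lift oU Up sx.
  have [W' [r' [oW' Wp' WU' sr' rE']]] := ample_local_lift oU Up sy.
  have oWW := openI oW oW'; exists (W `&` W') => //.
  apply: (msmooth_ext (f := fun q =>
      pairing S (r q) (v q) + pairing S (r' q) (u q))) => //.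
    move=> q [Wq W'q]; rewrite -rE // -rE' // ample_formE //.
      exact: Uu (WU q Wq).
    exact: Uv (WU q Wq).
  apply: msmoothD => //; apply: (pairing_smooth fS) => //.
  + by apply: smooth_onS sr => q [].
  + by apply: smooth_onS sv => q [/WU].
  + by apply: smooth_onS sr' => q [].
  + by apply: smooth_onS su => q [/WU].
Qed.

Lemma form_sec_ampleE (m m' : Gamma E1) (u v : Gamma E0) : in_ker rho u ->
  in_ker rho v -> form_sec ample_form (map_sec pr m, u) (map_sec pr m', v) =
  fun p => pairing S (m p) (v p) + pairing S (m' p) (u p).
Proof.
by move=> u0 v0; rewrite funeqE => p; exact: ample_formE (u0 p) (v0 p).
Qed.

Lemma ample_quadratic :
  quadratic_lie2_algebroid rho (map_sec ample_l1) ample_l2 ample_l3 ample_form.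
Proof.
have sec0 (A : bundle_data M) p : (0 : Gamma A) p = 0 by [].
have ker0 : in_ker rho 0 by move=> p; exact: linear0.
have kerd (m : Gamma E1) : in_ker rho (map_sec d m) by move=> p; exact: rho_d.
have kerx x u : in_ker rho u -> in_ker rho (op00 dia x u).
  by move=> /ker_rho_lift [m <-]; rewrite -(lb_a leib); exact: kerd.
split.
- exact: ample_lie2_algebroid.
- exact: exact_T exact_dia.
- exact: ample_graded_form.
- by move=> m; have [mt <-] := ample_lift m; rewrite map_sec_l1E.
- by move=> x u u0; rewrite ample_op00E; exact: kerx.
- move=> m m'; have [mt <-] := ample_lift m; have [mt' <-] := ample_lift m'.
  rewrite !map_sec_l1E -(map_sec0 pr) !form_sec_ampleE // funeqE => p.
  have := congr1 (fun f => f p) (clwx_d_sym clwx mt mt').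
  by rewrite /form_sec !(form_pairing fS) !sec0 /= !(pairing0l fS).
- move=> x u m u0; have [mt <-] := ample_lift m.
  rewrite ample_op00E ample_op01E -(map_sec0 pr) !form_sec_ampleE //; last exact: kerx.
  have E (m1 : Gamma E1) (v : Gamma E0) :
      (fun p => pairing S ((0 : Gamma E1) p) ((0 : Gamma E0) p) +
         pairing S (m1 p) (v p)) = fun p => pairing S (m1 p) (v p).
    by rewrite funeqE => p; rewrite (pairing0l fS) add0r.
  rewrite !E funeqE => p.
  by rewrite pairing_invariant !sec0 !(pairing0l fS) !add0r addrC.
- move=> x y u v u0 v0; rewrite /ample_l3 -(map_sec0 pr) !form_sec_ampleE //.
  rewrite funeqE => p.
  have := congr1 (fun f => f p) (clwx_Om_skew clwx x y u v).
  rewrite /form_sec !(form_pairing fS) !sec0 /= !(pairing0l fS).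
  by rewrite !addr0 !add0r.
Qed.

Lemma ample_extension : clwx_extension d ample_l1.
Proof.
exists rho_star_bmap; split.
- by [].
- move=> p; split.
  + by move=> a b; exact: (exact_rho_star exact_dia).
  + apply/seteqP; split=> [_ [a _ <-]|m /=].
      by rewrite /= -(linear0 (pr p)); apply/pr_eqP; rewrite linear0; exact: d_rho_star.
    rewrite -(linear0 (pr p)) => /pr_eqP; rewrite linear0 => /ker_dP [a <-].
    by exists a.
  + by apply/seteqP; split=> // x _; have [m <-] := pr_surj x; exists m.
- move=> p; split.
  + by move=> x y _; rewrite [x]thinmx0 [y]thinmx0.
  + apply/seteqP; split=> [_ [x _ <-] //|e /= ->].
    by exists 0.
  + by apply/seteqP; split=> // e _; exists e.
- by move=> p a; rewrite /= d_rho_star.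
- exact: ample_l1E.
Qed.

Lemma ample_structureP :
  ample_structure d dia Om ample_l1 ample_l2 ample_l3 ample_form.
Proof.
split.
- exact: ample_l1E.
- exact: ample_op00E.
- by move=> _ mt <- x; rewrite ample_op01E ample_op10E.
- by [].
- move=> p u m u0; rewrite -[X in (X, u)](linear0 (pr p)) ample_formE ?linear0 //.
  by rewrite (form_pairing fS) /= !(pairing0l fS).
Qed.

End Exact.

Theorem proposition5p5 (R : realType) (n : nat) (M : manifold R n)
    (E1 E0 : bundle_data M) (d : bundle_map E1 E0)
    (rho : bundle_map E0 (tangent M))
    (S : forall p, E1 p * E0 p -> E1 p * E0 p -> R)
    (dia : graded_op (Gamma E1) (Gamma E0)) (Om : form3 E0 E1) :
  exact_clwx2_algebroid d rho S dia Om ->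
  (forall m : Gamma (ample_F rho S), exists mt : Gamma E1,
     map_sec (ample_pr rho S) mt = m) /\
  exists (l1 : bundle_map (ample_F rho S) E0)
         (l2 : graded_op (Gamma (ample_F rho S)) (Gamma E0))
         (l3 : Gamma E0 -> Gamma E0 -> Gamma E0 -> Gamma (ample_F rho S))
         (SF : forall p, ample_F rho S p * E0 p -> ample_F rho S p * E0 p -> R),
    [/\ ample_structure d dia Om l1 l2 l3 SF,
        quadratic_lie2_algebroid rho (map_sec l1) l2 l3 SF
      & clwx_extension d l1].
Proof.
move=> ex; split; first exact: (ample_lift ex).
exists (ample_l1 ex), (ample_l2 ex), (ample_l3 rho S Om), (@ample_form _ _ _ _ _ rho S).
split; [exact: ample_structureP|exact: ample_quadratic|exact: ample_extension].
Qed.
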